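(* Let $\mathscr{C}$ be a fiat $2$-category over a field $\Bbbk$ and let $\mathbf{M}$ be an abelian $2$-representation of $\mathscr{C}$. Let $\mathbf{M}_{pr}$ be the finitary additive $2$-representation of $\mathscr{C}$ obtained by restricting the action of $\mathscr{C}$ to the full subcategories $\mathbf{M}_{pr}(\mathtt{i})\subset\mathbf{M}(\mathtt{i})$ of projective objects, and let $\overline{\mathbf{M}_{pr}}$ be its abelianization. Then the $2$-representations $\mathbf{M}$ and $\overline{\mathbf{M}_{pr}}$ of $\mathscr{C}$ are equivalent.
   Context: **Fiat $2$-categories.** A $2$-category is a (strict) category enriched over small categories; $\circ$ is composition of $1$-morphisms, $\circ_0$ and $\circ_1$ are horizontal and vertical composition of $2$-morphisms; $\mathrm{F}(\alpha):=\mathrm{id}_{\mathrm{F}}\circ_0\alpha$ and $\alpha_{\mathrm{F}}:=\alpha\circ_0\mathrm{id}_{\mathrm{F}}$. ''Fully additive'' means additive with split idempotents. A $2$-category $\mathscr{C}$ is fiat over the field $\Bbbk$ if: it has finitely many objects; every $\mathscr{C}(\mathtt{i},\mathtt{j})$ is a fully additive $\Bbbk$-linear category with finitely many indecomposable objects up to isomorphism; horizontal compositions are additive and $\Bbbk$-linear; all spaces of $2$-morphisms are finite dimensional; all identity $1$-morphisms $\mathbb{1}_{\mathtt{i}}$ are indecomposable; $\mathscr{C}$ has a weak object-preserving involutive anti-autoequivalence $*$; and for every $1$-morphism $\mathrm{F}\in\mathscr{C}(\mathtt{i},\mathtt{j})$ there are $2$-morphisms $\alpha:\mathrm{F}\circ\mathrm{F}^*\to\mathbb{1}_{\mathtt{j}}$,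 $\beta:\mathbb{1}_{\mathtt{i}}\to\mathrm{F}^*\circ\mathrm{F}$ with $\alpha_{\mathrm{F}}\circ_1\mathrm{F}(\beta)=\mathrm{id}_{\mathrm{F}}$ and $\mathrm{F}^*(\alpha)\circ_1\beta_{\mathrm{F}^*}=\mathrm{id}_{\mathrm{F}^*}$. **$2$-representations.** An abelian (resp. finitary) $2$-representation of $\mathscr{C}$ is a $2$-functor from $\mathscr{C}$ to the $2$-category whose objects are small $\Bbbk$-linear categories equivalent to module categories of finite dimensional $\Bbbk$-algebras (resp. small fully additive $\Bbbk$-linear categories with finitely many indecomposables up to isomorphism), whose $1$-morphisms are additive $\Bbbk$-linear functors and whose $2$-morphisms are natural transformations. $2$-functors and $2$-natural transformations are in the usual (strict) sense. **Projectives.** Because $\mathscr{C}$ is fiat, each $1$-morphism $\mathrm{F}$ acts on an abelian $2$-representation by a functor biadjoint to the exact action of $\mathrm{F}^*$, so it preserves projective objects; hence $\mathbf{M}_{pr}$ is well defined. **Abelianization.** For a finitary $\mathbf{N}$, $\overline{\mathbf{N}}(\mathtt{i})$ has objects the morphisms $X\xrightarrow{\alpha}Y$ of $\mathbf{N}(\mathtt{i})$; morphisms from $X\xrightarrow{\alpha}Y$ to $X'\xrightarrow{\alpha'}Y'$ are pairs $(\beta:X\to X',\gamma:Y\to Y')$ with $\gamma\alpha=\alpha'\beta$, modulo those for which there is $\xi:Y\to X'$ with $\gamma=\alpha'\xi$. $\mathscr{C}$ acts component-wise. **Equivalence.** Two $2$-representations $\mathbf{M},\mathbf{N}$ are elementary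 equivalent if there is a $2$-natural transformation $\Phi:\mathbf{M}\to\mathbf{N}$ or $\Phi:\mathbf{N}\to\mathbf{M}$ such that $\Phi_{\mathtt{i}}$ is an equivalence of categories for every object $\mathtt{i}$. They are equivalent if they are connected by a finite sequence of $2$-representations in which consecutive terms are elementary equivalent. *)

(* Defs.v *)
From HB Require Import structures.
From mathcomp Require Import all_boot all_algebra.
From mathcomp Require Import boolp.

(* Submodules are given by Prop-valued predicates; the classical axioms of boolp
   turn them into boolean ones, so that subspaces and quotients are again
   lmodTypes with Leibniz equality. *)

Set Implicit Arguments.
Unset Strict Implicit.
Unset Printing Implicit Defensive.

Import GRing.Theory.
Local Open Scope ring_scope.

Declare Scope twocat_scope.
Delimit Scope twocat_scope with twocat.
Local Open Scope twocat_scope.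

Reserved Notation "g \oc f" (at level 40, left associativity).
Reserved Notation "G \om F" (at level 40, left associativity).
Reserved Notation "b \oh a" (at level 40, left associativity).

Section LinearAlgebra.

Variable k : fieldType.

Record submodule (V : lmodType k) := Submodule {
  submodule_mem :> V -> Prop;
  submodule0 : submodule_mem 0;
  submoduleP : forall (a : k) u v,
    submodule_mem u -> submodule_mem v -> submodule_mem (a *: u + v) }.

Variables (V : lmodType k) (U : submodule V).

Definition smpred : {pred V} := fun v => `[< U v >].

Fact smpred_submod : submod_closed smpred.
Proof.
split; first by apply/asboolP; exact: submodule0.
by move=> a u v /asboolP Uu /asboolP Uv; apply/asboolP; exact: submoduleP.
Qed.

HB.instance Definition _ := GRing.isSubmodClosed.Build k V smpred smpred_submod.

Definition submod_type := {v : V | smpred v}.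

HB.instance Definition _ := SubChoice.on submod_type.
HB.instance Definition _ :=
  [SubChoice_isSubLmodule of submod_type by <:].

Definition quot_type := Quotient.quot smpred.

HB.instance Definition _ := GRing.Zmodule.on quot_type.

Definition quot_pi (v : V) : quot_type := (\pi_quot_type v)%qT.

Lemma quot_piP u v : quot_pi u = quot_pi v <-> U (u - v).
Proof.
rewrite /quot_pi; split=> [/eqP|Uuv].
  by rewrite -Quotient.idealrBE => /asboolP.
by apply/eqP; rewrite -Quotient.idealrBE; apply/asboolP.
Qed.

Definition quot_repr (q : quot_type) : V := generic_quotient.repr q.

Lemma quot_reprK : cancel quot_repr quot_pi.
Proof. exact: generic_quotient.reprK. Qed.

Lemma quot_piD u v : quot_pi (u + v) = quot_pi u + quot_pi v.
Proof. exact: Quotient.pi_add. Qed.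

Definition quot_scale (a : k) (q : quot_type) : quot_type :=
  quot_pi (a *: quot_repr q).

Lemma quot_pi_scale a v : quot_scale a (quot_pi v) = quot_pi (a *: v).
Proof.
apply/quot_piP; rewrite -scalerBr -[_ *: _]addr0.
by apply: submoduleP; [apply/quot_piP; rewrite quot_reprK|exact: submodule0].
Qed.

Fact quot_scalerA a b q :
  quot_scale a (quot_scale b q) = quot_scale (a * b) q.
Proof. by rewrite -[q]quot_reprK !quot_pi_scale scalerA. Qed.

Fact quot_scale1r : left_id 1 quot_scale.
Proof. by move=> q; rewrite -[q]quot_reprK quot_pi_scale scale1r. Qed.

Fact quot_scalerDr : right_distributive quot_scale +%R.
Proof.
move=> a p q; rewrite -[p]quot_reprK -[q]quot_reprK -quot_piD !quot_pi_scale.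
by rewrite scalerDr quot_piD.
Qed.

Fact quot_scalerDl q : {morph quot_scale^~ q : a b / a + b}.
Proof.
by move=> a b; rewrite -[q]quot_reprK !quot_pi_scale scalerDl quot_piD.
Qed.

HB.instance Definition _ := GRing.Zmodule_isLmodule.Build k quot_type
  quot_scalerA quot_scale1r quot_scalerDr quot_scalerDl.

Fact quot_pi_linear : linear quot_pi.
Proof. by move=> a u v; rewrite quot_piD -quot_pi_scale. Qed.

HB.instance Definition _ := GRing.isLinear.Build k V quot_type _ quot_pi
  quot_pi_linear.

End LinearAlgebra.

Definition finite_dimensional (k : fieldType) (V : lmodType k) :=
  exists n (v : 'I_n -> V),
    forall u, exists c : 'I_n -> k, u = \sum_p c p *: v p.

Record kcat (k : fieldType) := KCat {
  ob :> Type;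
  hom : ob -> ob -> lmodType k;
  idm : forall X, hom X X;
  comp : forall X Y Z, hom Y Z -> hom X Y -> hom X Z;
  compA : forall W X Y Z (h : hom Y Z) (g : hom X Y) (f : hom W X),
    comp h (comp g f) = comp (comp h g) f;
  comp1m : forall X Y (f : hom X Y), comp (idm Y) f = f;
  compm1 : forall X Y (f : hom X Y), comp f (idm X) = f;
  comp_linearl : forall X Y Z (f : hom X Y),
    linear (fun g : hom Y Z => comp g f);
  comp_linearr : forall X Y Z (g : hom Y Z),
    linear (fun f : hom X Y => comp g f) }.

Arguments hom {k k0} X Y : rename.
Arguments idm {k k0} X : rename.
Arguments comp {k k0 X Y Z} g f : rename.

Notation "g \oc f" := (comp g f) : twocat_scope.

Section Categories.

Variable k : fieldType.
Implicit Types K L M : kcat k.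

Definition is_iso K (X Y : K) (f : hom X Y) :=
  exists g : hom Y X, g \oc f = idm X /\ f \oc g = idm Y.

Definition isomorphic K (X Y : K) := exists f : hom X Y, is_iso f.

Definition is_epi K (X Y : K) (e : hom X Y) :=
  forall Z (u v : hom Y Z), u \oc e = v \oc e -> u = v.

Definition is_zero K (X : K) := idm X = 0.

Definition is_biproduct K (Z X Y : K) :=
  exists (i1 : hom X Z) (i2 : hom Y Z) (p1 : hom Z X) (p2 : hom Z Y),
    [/\ p1 \oc i1 = idm X, p2 \oc i2 = idm Y, p1 \oc i2 = 0, p2 \oc i1 = 0
      & i1 \oc p1 + i2 \oc p2 = idm Z].

Definition additive_category K :=
  (exists Z : K, is_zero Z) /\
  (forall X Y : K, exists Z : K, is_biproduct Z X Y).

Definition idempotents_split K :=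
  forall (X : K) (e : hom X X), e \oc e = e ->
    exists (Y : K) (p : hom X Y) (i : hom Y X), i \oc p = e /\ p \oc i = idm Y.

Definition fully_additive K := additive_category K /\ idempotents_split K.

Definition indecomposable K (X : K) :=
  ~ is_zero X /\ forall Y Z : K, is_biproduct X Y Z -> is_zero Y \/ is_zero Z.

Definition finitely_many_indecomposables K :=
  exists n (x : 'I_n -> K),
    forall X : K, indecomposable X -> exists p, isomorphic X (x p).

Definition projective K (P : K) :=
  forall (X Y : K) (e : hom X Y) (f : hom P Y), is_epi e ->
    exists g : hom P X, e \oc g = f.

(* The identity morphism seen as a morphism between propositionally equal
   objects; all strictness laws between morphisms are stated with it. *)
Definition eqhom K (X Y : K) (e : X = Y) : hom X Y :=
  match e in _ = Z return hom X Z with erefl => idm X end.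

Lemma eqhom_id K (X : K) (e : X = X) : eqhom e = idm X.
Proof. by rewrite (Prop_irrelevance e erefl). Qed.

Lemma eqhom_comp K (X Y Z : K) (e : X = Y) (e' : Y = Z) :
  eqhom e' \oc eqhom e = eqhom (etrans e e').
Proof. by case: Z / e'; case: Y / e; rewrite comp1m. Qed.

Lemma eqhom_irr K (X Y : K) (e e' : X = Y) : eqhom e = eqhom e'.
Proof. by rewrite (Prop_irrelevance e e'). Qed.

Record functor K L := Functor {
  fob :> K -> L;
  fmor : forall X Y : K, hom X Y -> hom (fob X) (fob Y);
  fmor1 : forall X, fmor (idm X) = idm (fob X);
  fmorM : forall X Y Z (g : hom Y Z) (f : hom X Y),
    fmor (g \oc f) = fmor g \oc fmor f;
  fmor_linear : forall X Y, linear (@fmor X Y) }.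

Arguments fmor {K L} _ {X Y} _.

Definition functor1 K : functor K K.
Proof.
by refine (@Functor K K (fun X => X) (fun X Y f => f) _ _ _).
Defined.

Definition functorM K L M (G : functor L M) (F : functor K L) : functor K M.
Proof.
refine (@Functor K M (fun X => G (F X)) (fun X Y f => fmor G (fmor F f)) _ _ _).
- by move=> X; rewrite !fmor1.
- by move=> X Y Z g f; rewrite !fmorM.
- by move=> X Y a f g; rewrite !fmor_linear.
Defined.

Definition eq_fob K L (F G : functor K L) (e : F = G) (X : K) : F X = G X :=
  congr1 (fun H : functor K L => H X) e.

Record nattrans K L (F G : functor K L) := NatTrans {
  ncomp :> forall X, hom (F X) (G X);
  ncomp_natural : forall X Y (f : hom X Y),
    ncomp Y \oc fmor F f = fmor G f \oc ncomp X }.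

Definition is_equivalence K L (F : functor K L) :=
  exists (G : functor L K)
         (eta : nattrans (functorM G F) (functor1 K))
         (eps : nattrans (functorM F G) (functor1 L)),
    (forall X, is_iso (eta X)) /\ (forall Y, is_iso (eps Y)).

Lemma eqhom_fmor K L (F : functor K L) (X Y : K) (e : X = Y) :
  fmor F (eqhom e) = eqhom (congr1 F e).
Proof. by case: Y / e; rewrite /= fmor1. Qed.

Lemma eq_fmor K L (F G : functor K L) (e : F = G) X Y (f : hom X Y) :
  eqhom (eq_fob e Y) \oc fmor F f = fmor G f \oc eqhom (eq_fob e X).
Proof. by case: G / e; rewrite /= comp1m compm1. Qed.

Lemma functor_ext K L (F G : functor K L) (e : forall X, F X = G X) :
  (forall X Y (f : hom X Y),
     eqhom (e Y) \oc fmor F f = fmor G f \oc eqhom (e X)) -> F = G.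
Proof.
case: F e => fo fm f1 fM fl; case: G => go gm g1 gM gl /= e.
have eo : fo = go by apply: funext.
case: go / eo gm g1 gM gl e => gm g1 gM gl e em.
have efg : fm = gm.
  apply: functional_extensionality_dep => X.
  apply: functional_extensionality_dep => Y.
  apply: funext => f.
  by have := em X Y f; rewrite !eqhom_id comp1m compm1.
case: gm / efg g1 gM gl em => g1 gM gl _.
rewrite (Prop_irrelevance f1 g1) (Prop_irrelevance fM gM).
by rewrite (Prop_irrelevance fl gl).
Qed.

Section FullSubcategory.

Variables (K : kcat k) (P : K -> Prop).

Definition fullsub : kcat k.
Proof.
refine (@KCat k {X : K | P X} (fun X Y => hom (sval X) (sval Y))
  (fun X => idm (sval X)) (fun X Y Z g f => g \oc f) _ _ _ _ _).
- by move=> *; exact: compA.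
- by move=> *; exact: comp1m.
- by move=> *; exact: compm1.
- by move=> *; exact: comp_linearl.
- by move=> *; exact: comp_linearr.
Defined.

Lemma fullsub_ext (X Y : fullsub) : sval X = sval Y -> X = Y.
Proof.
case: X Y => X PX [Y PY] /= e; case: Y / e PY => PY.
by rewrite (Prop_irrelevance PX PY).
Qed.

Lemma eqhom_fullsub (X Y : fullsub) (e : X = Y) (e' : sval X = sval Y) :
  eqhom e = eqhom e' :> hom (sval X) (sval Y).
Proof. by case: Y / e e' => e'; rewrite (eqhom_id e'). Qed.

End FullSubcategory.

Definition functor_restr K L (P : K -> Prop) (Q : L -> Prop) (F : functor K L)
  (PQ : forall X, P X -> Q (F X)) : functor (fullsub P) (fullsub Q).
Proof.
refine (@Functor (fullsub P) (fullsub Q)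
  (fun X => exist Q (F (sval X)) (PQ _ (svalP X))) (fun X Y f => fmor F f)
  _ _ _).
- by move=> X; exact: (fmor1 F).
- by move=> X Y Z g f; exact: (fmorM F g f).
- by move=> X Y a f g; exact: (fmor_linear F a f g).
Defined.

Definition nattrans_restr K L (P : K -> Prop) (Q : L -> Prop)
  (F G : functor K L) (PF : forall X, P X -> Q (F X))
  (PG : forall X, P X -> Q (G X)) (a : nattrans F G) :
  nattrans (functor_restr PF) (functor_restr PG).
Proof.
refine (@NatTrans (fullsub P) (fullsub Q) (functor_restr PF) (functor_restr PG)
  (fun X => a (sval X)) _).
by move=> X Y f; exact: (ncomp_natural a f).
Defined.

End Categories.

Arguments fmor {k K L} _ {X Y} _.
Arguments functor1 {k} K.

Section CompositionLinear.

Variables (k : fieldType) (K : kcat k).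
Implicit Types X Y Z : K.

Lemma comp0m X Y Z (f : hom X Y) : (0 : hom Y Z) \oc f = 0.
Proof.
have := comp_linearl f (-1) (0 : hom Y Z) 0.
by rewrite !scaleN1r oppr0 addr0 addNr.
Qed.

Lemma compm0 X Y Z (g : hom Y Z) : g \oc (0 : hom X Y) = 0.
Proof.
have := comp_linearr g (-1) (0 : hom X Y) 0.
by rewrite !scaleN1r oppr0 addr0 addNr.
Qed.

Lemma compDm X Y Z (f : hom X Y) (g h : hom Y Z) :
  (g + h) \oc f = g \oc f + h \oc f.
Proof. by have := comp_linearl f 1 g h; rewrite !scale1r. Qed.

Lemma compmD X Y Z (g : hom Y Z) (f h : hom X Y) :
  g \oc (f + h) = g \oc f + g \oc h.
Proof. by have := comp_linearr g 1 f h; rewrite !scale1r. Qed.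

Lemma compNm X Y Z (f : hom X Y) (g : hom Y Z) : (- g) \oc f = - (g \oc f).
Proof.
have := comp_linearl f (-1) g 0.
by rewrite !scaleN1r !addr0 comp0m addr0.
Qed.

Lemma compmN X Y Z (g : hom Y Z) (f : hom X Y) : g \oc (- f) = - (g \oc f).
Proof.
have := comp_linearr g (-1) f 0.
by rewrite !scaleN1r !addr0 compm0 addr0.
Qed.

Lemma compZm X Y Z a (f : hom X Y) (g : hom Y Z) :
  (a *: g) \oc f = a *: (g \oc f).
Proof. by have := comp_linearl f a g 0; rewrite comp0m !addr0. Qed.

Lemma compmZ X Y Z a (g : hom Y Z) (f : hom X Y) :
  g \oc (a *: f) = a *: (g \oc f).
Proof. by have := comp_linearr g a f 0; rewrite compm0 !addr0. Qed.

End CompositionLinear.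

Section FunctorLinear.

Variables (k : fieldType) (K L : kcat k) (F : functor K L).

Lemma fmor0 (X Y : K) : fmor F (0 : hom X Y) = 0.
Proof.
have := fmor_linear F (-1) (0 : hom X Y) 0.
by rewrite !scaleN1r oppr0 addr0 addNr.
Qed.

Lemma fmorD (X Y : K) (f g : hom X Y) : fmor F (f + g) = fmor F f + fmor F g.
Proof. by have := fmor_linear F 1 f g; rewrite !scale1r. Qed.

Lemma fmorB (X Y : K) (f g : hom X Y) : fmor F (f - g) = fmor F f - fmor F g.
Proof.
by have := fmor_linear F (-1) g f; rewrite !scaleN1r ![- _ + _]addrC.
Qed.

Lemma fmorZ (X Y : K) a (f : hom X Y) : fmor F (a *: f) = a *: fmor F f.
Proof. by have := fmor_linear F a f 0; rewrite fmor0 !addr0. Qed.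

End FunctorLinear.

Section Abelianization.

Variables (k : fieldType) (K : kcat k).

(* The object X -> Y stands for its cokernel; the quotient by [null_square]
   identifies commutative squares inducing the same map of cokernels. *)
Record arrow := Arrow { asrc : K; atgt : K; amap : hom asrc atgt }.

Section Hom.

Variables A B : arrow.

Definition square_submodule :
  submodule (hom (asrc A) (asrc B) * hom (atgt A) (atgt B))%type.
Proof.
refine (@Submodule k _ (fun p => p.2 \oc amap A = amap B \oc p.1) _ _).
- by rewrite /= comp0m compm0.
- move=> a u v /= eu ev.
  by rewrite compDm compmD compZm compmZ eu ev.
Defined.

Definition square := submod_type square_submodule.

Lemma squareP (s : square) : (val s).2 \oc amap A = amap B \oc (val s).1.
Proof. exact: (asboolW (svalP s)). Qed.

Definition mk_square (b : hom (asrc A) (asrc B)) (c : hom (atgt A) (atgt B))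
  (e : c \oc amap A = amap B \oc b) : square :=
  Sub (b, c) (asboolT e : (b, c) \in smpred square_submodule).

Definition null_square : submodule square.
Proof.
refine (@Submodule k _ (fun s => exists xi : hom (atgt A) (asrc B),
  (val s).2 = amap B \oc xi) _ _).
- by exists 0; rewrite compm0.
- move=> a u v [xi eu] [zeta ev]; exists (a *: xi + zeta).
  by rewrite compmD compmZ -eu -ev.
Defined.

Definition abhom : lmodType k := quot_type null_square.

Definition abpi (s : square) : abhom := quot_pi null_square s.

Lemma abpi_eq (s t : square) : (val s).2 = (val t).2 -> abpi s = abpi t.
Proof.
by move=> e; apply/quot_piP; exists 0; rewrite compm0 /= e subrr.
Qed.

Lemma abpi_ind (P : abhom -> Prop) :
  (forall s, P (abpi s)) -> forall f, P f.
Proof. by move=> H f; rewrite -(quot_reprK f). Qed.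

End Hom.

Definition square1 (A : arrow) : square A A :=
  @mk_square A A (idm _) (idm _) (etrans (comp1m _) (esym (compm1 _))).

Fact squareM_subproof A B C (t : square B C) (s : square A B) :
  ((val t).2 \oc (val s).2) \oc amap A = amap C \oc ((val t).1 \oc (val s).1).
Proof. by rewrite -compA squareP !compA squareP. Qed.

Definition squareM A B C (t : square B C) (s : square A B) : square A C :=
  mk_square (squareM_subproof t s).

Definition abcomp A B C (g : abhom B C) (f : abhom A B) : abhom A C :=
  abpi (squareM (quot_repr g) (quot_repr f)).

Lemma abcomp_pi A B C (t : square B C) (s : square A B) :
  abcomp (abpi t) (abpi s) = abpi (squareM t s).
Proof.
apply/quot_piP => /=.
have /quot_piP[xi /= exi] := quot_reprK (abpi t).
have /quot_piP[zeta /= ezeta] := quot_reprK (abpi s).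
set t' := quot_repr _ in exi *; set s' := quot_repr _ in ezeta *.
exists (xi \oc (val s').2 + (val t).1 \oc zeta).
rewrite compmD compA -exi compA -squareP -compA -ezeta.
by rewrite compDm compmD compNm compmN addrA subrK.
Qed.

Lemma abcompA A B C D (h : abhom C D) (g : abhom B C) (f : abhom A B) :
  abcomp h (abcomp g f) = abcomp (abcomp h g) f.
Proof.
elim/abpi_ind: h => h; elim/abpi_ind: g => g; elim/abpi_ind: f => f.
by rewrite !abcomp_pi; apply: abpi_eq; rewrite /= compA.
Qed.

Lemma abcomp1m A B (f : abhom A B) : abcomp (abpi (square1 B)) f = f.
Proof.
by elim/abpi_ind: f => f; rewrite abcomp_pi; apply: abpi_eq; rewrite /= comp1m.
Qed.

Lemma abcompm1 A B (f : abhom A B) : abcomp f (abpi (square1 A)) = f.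
Proof.
by elim/abpi_ind: f => f; rewrite abcomp_pi; apply: abpi_eq; rewrite /= compm1.
Qed.

Lemma abpiP A B a (s t : square A B) : abpi (a *: s + t) = a *: abpi s + abpi t.
Proof. exact: linearP. Qed.

Lemma abcomp_linearl A B C (f : abhom A B) :
  linear (fun g : abhom B C => abcomp g f).
Proof.
move=> a g h; elim/abpi_ind: g => g; elim/abpi_ind: h => h.
elim/abpi_ind: f => f; rewrite -abpiP !abcomp_pi -abpiP.
by apply: abpi_eq; rewrite /= compDm compZm.
Qed.

Lemma abcomp_linearr A B C (g : abhom B C) :
  linear (fun f : abhom A B => abcomp g f).
Proof.
move=> a f h; elim/abpi_ind: g => g; elim/abpi_ind: h => h.
elim/abpi_ind: f => f; rewrite -abpiP !abcomp_pi -abpiP.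
by apply: abpi_eq; rewrite /= compmD compmZ.
Qed.

Definition abcat : kcat k :=
  @KCat k arrow abhom (fun A => abpi (square1 A)) abcomp
    abcompA abcomp1m abcompm1 abcomp_linearl abcomp_linearr.

Lemma arrow_ext (A B : arrow) (e1 : asrc A = asrc B) (e2 : atgt A = atgt B) :
  eqhom e2 \oc amap A = amap B \oc eqhom e1 -> A = B.
Proof.
case: A B e1 e2 => X Y f [X' Y' f'] /= e1 e2.
case: X' / e1 f' => f'; case: Y' / e2 f' => f' /=.
by rewrite comp1m compm1 => ->.
Qed.

Lemma eqhom_abcat (A B : abcat) (e : A = B) (e2 : atgt A = atgt B) :
  exists2 s : square A B, (val s).2 = eqhom e2 & eqhom e = abpi s.
Proof.
by case: B / e e2 => e2; exists (square1 A); rewrite ?eqhom_id.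
Qed.

End Abelianization.

Section AbelianizationFunctorial.

Variables (k : fieldType) (K L : kcat k).

Section Functor.

Variable F : functor K L.

Definition arrow_map (A : arrow K) : arrow L := Arrow (fmor F (amap A)).

Fact square_map_subproof A B (s : square A B) :
  fmor F (val s).2 \oc amap (arrow_map A)
  = amap (arrow_map B) \oc fmor F (val s).1.
Proof. by rewrite /= -!fmorM squareP. Qed.

Definition square_map A B (s : square A B) :
    square (arrow_map A) (arrow_map B) :=
  @mk_square k L (arrow_map A) (arrow_map B) _ _ (square_map_subproof s).

Definition abmap A B (f : abhom A B) : abhom (arrow_map A) (arrow_map B) :=
  abpi (square_map (quot_repr f)).

Lemma abmap_pi A B (s : square A B) : abmap (abpi s) = abpi (square_map s).
Proof.
apply/quot_piP; have /quot_piP[xi /= exi] := quot_reprK (abpi s).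
by exists (fmor F xi); rewrite /= -fmorM -exi fmorB.
Qed.

Definition abfunctor : functor (abcat K) (abcat L).
Proof.
refine (@Functor k (abcat K) (abcat L) arrow_map abmap _ _ _).
- move=> A; rewrite [LHS]abmap_pi.
  by apply: (@abpi_eq k L _ _ _ (square1 _)); exact: (fmor1 F).
- move=> A B C g f; elim/abpi_ind: g => g; elim/abpi_ind: f => f.
  rewrite -[_ \oc _]/(abcomp _ _) abcomp_pi !abmap_pi -[RHS]/(abcomp _ _).
  by rewrite abcomp_pi; apply: (@abpi_eq k L); exact: (fmorM F).
- move=> A B a f g; elim/abpi_ind: g => g; elim/abpi_ind: f => f.
  rewrite -abpiP !abmap_pi -abpiP.
  by apply: (@abpi_eq k L); exact: (fmor_linear F).
Defined.

End Functor.

Section Nattrans.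

Variables (F G : functor K L) (a : nattrans F G).

Definition square_nat (A : arrow K) : square (arrow_map F A) (arrow_map G A) :=
  @mk_square k L (arrow_map F A) (arrow_map G A)
    (a (asrc A)) (a (atgt A)) (ncomp_natural a (amap A)).

Definition abnattrans : nattrans (abfunctor F) (abfunctor G).
Proof.
refine (@NatTrans k (abcat K) (abcat L) (abfunctor F) (abfunctor G)
  (fun A => abpi (square_nat A)) _).
move=> A B f; elim/abpi_ind: f => f.
rewrite -[LHS]/(abcomp _ _) -[RHS]/(abcomp _ _) /= !abmap_pi !abcomp_pi.
apply: (@abpi_eq k L (arrow_map F A) (arrow_map G B)).
exact: (ncomp_natural a).
Defined.

End Nattrans.

End AbelianizationFunctorial.

(* Strict k-linear 2-categories: the hom-categories [hom1 i j] are k-linear and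
   horizontal composition is k-bilinear on 2-morphisms.  [G \om F] is the
   composite of F : i -> j and G : j -> l, vertical composition is the
   composition [\oc] of the hom-categories, and [\oh] is horizontal. *)
Record twocat (k : fieldType) := TwoCat {
  obj :> Type;
  hom1 : obj -> obj -> kcat k;
  one1 : forall i, hom1 i i;
  comp1 : forall i j l, hom1 j l -> hom1 i j -> hom1 i l;
  hcomp : forall i j l (G G' : hom1 j l) (F F' : hom1 i j),
    hom G G' -> hom F F' -> hom (comp1 G F) (comp1 G' F');
  hcomp_idm : forall i j l (G : hom1 j l) (F : hom1 i j),
    hcomp (idm G) (idm F) = idm (comp1 G F);
  hcomp_interchange : forall i j l (G G' G'' : hom1 j l) (F F' F'' : hom1 i j)
      (b : hom G G') (b' : hom G' G'') (a : hom F F') (a' : hom F' F''),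
    hcomp (b' \oc b) (a' \oc a) = hcomp b' a' \oc hcomp b a;
  hcomp_linearl : forall i j l (G G' : hom1 j l) (F F' : hom1 i j)
      (a : hom F F'),
    linear (fun b : hom G G' => hcomp b a);
  hcomp_linearr : forall i j l (G G' : hom1 j l) (F F' : hom1 i j)
      (b : hom G G'),
    linear (fun a : hom F F' => hcomp b a);
  comp1A : forall i j l m (H : hom1 l m) (G : hom1 j l) (F : hom1 i j),
    comp1 H (comp1 G F) = comp1 (comp1 H G) F;
  comp1_onel : forall i j (F : hom1 i j), comp1 (one1 j) F = F;
  comp1_oner : forall i j (F : hom1 i j), comp1 F (one1 i) = F;
  hcompA : forall i j l m (H H' : hom1 l m) (G G' : hom1 j l)
      (F F' : hom1 i j) (c : hom H H') (b : hom G G') (a : hom F F'),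
    eqhom (comp1A H' G' F') \oc hcomp c (hcomp b a)
    = hcomp (hcomp c b) a \oc eqhom (comp1A H G F);
  hcomp_onel : forall i j (F F' : hom1 i j) (a : hom F F'),
    eqhom (comp1_onel F') \oc hcomp (idm (one1 j)) a
    = a \oc eqhom (comp1_onel F);
  hcomp_oner : forall i j (F F' : hom1 i j) (a : hom F F'),
    eqhom (comp1_oner F') \oc hcomp a (idm (one1 i))
    = a \oc eqhom (comp1_oner F) }.

Arguments hom1 {k} t i j.
Arguments one1 {k t} i.
Arguments comp1 {k t i j l} G F : rename.
Arguments hcomp {k t i j l G G' F F'} b a : rename.

Notation "G \om F" := (comp1 G F) : twocat_scope.
Notation "b \oh a" := (hcomp b a) : twocat_scope.

Section Fiat.

Variables (k : fieldType) (C : twocat k).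

(* A weak (pseudo) 2-functor from C to itself that is the identity on objects
   and reverses the direction of both 1-morphisms and 2-morphisms, together
   with an invertible transformation with identity 1-morphism components from
   the identity to its square.  In particular it is a biequivalence. *)
Record weak_anti_involution := WeakAntiInvolution {
  dual : forall i j : C, hom1 C i j -> hom1 C j i;
  dual2 : forall (i j : C) (F G : hom1 C i j),
    hom F G -> hom (dual G) (dual F);
  dual2_idm : forall (i j : C) (F : hom1 C i j),
    dual2 (idm F) = idm (dual F);
  dual2_comp : forall (i j : C) (F G H : hom1 C i j)
      (b : hom G H) (a : hom F G),
    dual2 (b \oc a) = dual2 a \oc dual2 b;
  dualM : forall (i j l : C) (G : hom1 C j l) (F : hom1 C i j),
    hom (dual F \om dual G) (dual (G \om F));
  dualM_iso : forall (i j l : C) (G : hom1 C j l) (F : hom1 C i j),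
    is_iso (dualM G F);
  dualM_natural : forall (i j l : C) (G G' : hom1 C j l) (F F' : hom1 C i j)
      (b : hom G G') (a : hom F F'),
    dualM G F \oc (dual2 a \oh dual2 b) = dual2 (b \oh a) \oc dualM G' F';
  dual1 : forall i : C, hom (one1 i) (dual (one1 i));
  dual1_iso : forall i : C, is_iso (dual1 i);
  dualM_assoc : forall (i j l m : C) (H : hom1 C l m) (G : hom1 C j l)
      (F : hom1 C i j),
    eqhom (congr1 (@dual i m) (comp1A H G F)) \oc
      (dualM H (G \om F) \oc (dualM G F \oh idm (dual H)))
    = dualM (H \om G) F \oc (idm (dual F) \oh dualM H G)
        \oc eqhom (esym (comp1A (dual F) (dual G) (dual H)));
  dualM_oner : forall (i j : C) (F : hom1 C i j),
    eqhom (congr1 (@dual i j) (comp1_oner F)) \oc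
      (dualM F (one1 i) \oc (dual1 i \oh idm (dual F)))
    = eqhom (comp1_onel (dual F));
  dualM_onel : forall (i j : C) (F : hom1 C i j),
    eqhom (congr1 (@dual i j) (comp1_onel F)) \oc
      (dualM (one1 j) F \oc (idm (dual F) \oh dual1 j))
    = eqhom (comp1_oner (dual F));
  bidual : forall (i j : C) (F : hom1 C i j), hom F (dual (dual F));
  bidual_iso : forall (i j : C) (F : hom1 C i j), is_iso (bidual F);
  bidual_natural : forall (i j : C) (F G : hom1 C i j) (a : hom F G),
    bidual G \oc a = dual2 (dual2 a) \oc bidual F;
  bidual_comp : forall (i j l : C) (G : hom1 C j l) (F : hom1 C i j),
    dual2 (dualM G F) \oc bidual (G \om F)
    = dualM (dual F) (dual G) \oc (bidual G \oh bidual F);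
  bidual_one : forall i : C, dual2 (dual1 i) \oc bidual (one1 i) = dual1 i }.

(* The triangle identities, with the strict associativity and unit laws
   inserted. *)
Definition adjunction_morphisms (i j : C) (F : hom1 C i j) (G : hom1 C j i)
    (alpha : hom (F \om G) (one1 j)) (beta : hom (one1 i) (G \om F)) :=
  eqhom (comp1_onel F) \oc (alpha \oh idm F) \oc eqhom (comp1A F G F)
    \oc (idm F \oh beta) \oc eqhom (esym (comp1_oner F)) = idm F
  /\
  eqhom (comp1_oner G) \oc (idm G \oh alpha) \oc eqhom (esym (comp1A G F G))
    \oc (beta \oh idm G) \oc eqhom (esym (comp1_onel G)) = idm G.

Record fiat : Prop := Fiat {
  fiat_obj : exists n (x : 'I_n -> C), forall i : C, exists p, x p = i;
  fiat_fully_additive : forall i j : C, fully_additive (hom1 C i j);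
  fiat_indecomposables : forall i j : C,
    finitely_many_indecomposables (hom1 C i j);
  fiat_hom : forall (i j : C) (F G : hom1 C i j), finite_dimensional (hom F G);
  fiat_one : forall i : C, indecomposable (one1 i);
  fiat_dual : exists S : weak_anti_involution,
    forall (i j : C) (F : hom1 C i j),
      exists (alpha : hom (F \om dual S F) (one1 j))
             (beta : hom (one1 i) (dual S F \om F)),
        adjunction_morphisms alpha beta }.

End Fiat.

Section Representations.

Variables (k : fieldType) (C : twocat k).

(* Strict 2-functors from C to the 2-category of k-linear categories, k-linear
   functors and natural transformations; k-linear functors are additive. *)
Record tworep := TwoRep {
  tcat :> C -> kcat k;
  tfun : forall i j : C, hom1 C i j -> functor (tcat i) (tcat j);
  tnat : forall (i j : C) (F G : hom1 C i j),
    hom F G -> nattrans (tfun F) (tfun G);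
  tnat_idm : forall (i j : C) (F : hom1 C i j) (X : tcat i),
    tnat (idm F) X = idm (tfun F X);
  tnat_comp : forall (i j : C) (F G H : hom1 C i j) (b : hom G H) (a : hom F G)
      (X : tcat i),
    tnat (b \oc a) X = tnat b X \oc tnat a X;
  tfun_one : forall i : C, tfun (one1 i) = functor1 (tcat i);
  tfun_comp : forall (i j l : C) (G : hom1 C j l) (F : hom1 C i j),
    tfun (G \om F) = functorM (tfun G) (tfun F);
  tnat_hcomp : forall (i j l : C) (G G' : hom1 C j l) (F F' : hom1 C i j)
      (b : hom G G') (a : hom F F') (X : tcat i),
    eqhom (eq_fob (tfun_comp G' F') X) \oc tnat (b \oh a) X
    = tnat b (tfun F' X) \oc fmor (tfun G) (tnat a X)
        \oc eqhom (eq_fob (tfun_comp G F) X) }.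

Arguments tfun t {i j} F.
Arguments tnat t {i j F G} a : rename.

Record twonat (M N : tworep) := TwoNat {
  tncomp :> forall i : C, functor (M i) (N i);
  tncomp_tfun : forall (i j : C) (F : hom1 C i j),
    functorM (tncomp j) (tfun M F) = functorM (tfun N F) (tncomp i);
  tncomp_tnat : forall (i j : C) (F G : hom1 C i j) (a : hom F G) (X : M i),
    eqhom (eq_fob (tncomp_tfun G) X) \oc fmor (tncomp j) (tnat M a X)
    = tnat N a (tncomp i X) \oc eqhom (eq_fob (tncomp_tfun F) X) }.

Definition elementary_equivalent (M N : tworep) :=
  (exists Phi : twonat M N, forall i, is_equivalence (Phi i)) \/
  (exists Phi : twonat N M, forall i, is_equivalence (Phi i)).

End Representations.

Arguments tfun {k C} t {i j} F.
Arguments tnat {k C} t {i j F G} a : rename.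

Section ModuleCategory.

Variable k : fieldType.

(* Unlike [falgType k], this allows the zero algebra. *)
Record fdalgebra := FdAlgebra {
  acar : vectType k;
  aone : acar;
  amul : acar -> acar -> acar;
  amulA : associative amul;
  amul1l : left_id aone amul;
  amul1r : right_id aone amul;
  amul_linearl : forall b, linear (amul^~ b);
  amul_linearr : forall a, linear (amul a) }.

Record fdmodule (A : fdalgebra) := FdModule {
  mcar : vectType k;
  mact : acar A -> 'End(mcar);
  mact_linear : linear mact;
  mact_one : mact (aone A) = \1%VF;
  mact_mul : forall a b, mact (amul a b) = (mact a \o mact b)%VF }.

Variable A : fdalgebra.

Definition module_hom_submodule (V W : fdmodule A) :
  submodule 'Hom(mcar V, mcar W).
Proof.
refine (@Submodule k _
  (fun f => forall a, (f \o mact V a = mact W a \o f)%VF) _ _).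
- by move=> a; rewrite comp_lfun0l comp_lfun0r.
- move=> c f g ef eg a.
  by rewrite comp_lfunDl comp_lfunDr -comp_lfunZl -comp_lfunZr ef eg.
Defined.

Definition module_hom (V W : fdmodule A) : lmodType k :=
  submod_type (module_hom_submodule V W).

Lemma module_homP (V W : fdmodule A) (f : module_hom V W) a :
  (val f \o mact V a = mact W a \o val f)%VF.
Proof. exact: (asboolW (svalP f)). Qed.

Definition mk_module_hom (V W : fdmodule A) (f : 'Hom(mcar V, mcar W))
    (e : forall a, (f \o mact V a = mact W a \o f)%VF) : module_hom V W :=
  Sub f (asboolT e : f \in smpred (module_hom_submodule V W)).

Fact module_id_subproof (V : fdmodule A) a :
  (\1%VF \o mact V a = mact V a \o \1%VF)%VF.
Proof. by rewrite comp_lfun1l comp_lfun1r. Qed.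

Definition module_id (V : fdmodule A) : module_hom V V :=
  mk_module_hom (@module_id_subproof V).

Fact module_comp_subproof (U V W : fdmodule A) (g : module_hom V W)
    (f : module_hom U V) a :
  ((val g \o val f) \o mact U a = mact W a \o (val g \o val f))%VF.
Proof. by rewrite -comp_lfunA module_homP !comp_lfunA module_homP. Qed.

Definition module_comp (U V W : fdmodule A) (g : module_hom V W)
    (f : module_hom U V) : module_hom U W :=
  mk_module_hom (module_comp_subproof g f).

Definition modcat : kcat k.
Proof.
refine (@KCat k (fdmodule A) module_hom module_id module_comp _ _ _ _ _).
- by move=> *; apply: val_inj; exact: comp_lfunA.
- by move=> *; apply: val_inj; exact: comp_lfun1l.
- by move=> *; apply: val_inj; exact: comp_lfun1r.
- move=> U V W f a g h; apply: val_inj => /=.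
  by rewrite comp_lfunDl -comp_lfunZl.
- move=> U V W g a f h; apply: val_inj => /=.
  by rewrite comp_lfunDr -comp_lfunZr.
Defined.

End ModuleCategory.

Section AbelianRepresentations.

Variables (k : fieldType) (C : twocat k).

Definition abelian_rep (M : tworep C) :=
  forall i : C, exists (A : fdalgebra k) (E : functor (M i) (modcat A)),
    is_equivalence E.

(* Equivalence of abelian 2-representations: both ends and all intermediate
   terms of the sequence are abelian 2-representations. *)
Definition rep_equivalent (M N : tworep C) :=
  exists (n : nat) (S : nat -> tworep C),
    [/\ S 0%N = M, S n = N,
        forall p, (p <= n)%N -> abelian_rep (S p)
      & forall p, (p < n)%N -> elementary_equivalent (S p) (S p.+1)].

End AbelianRepresentations.

Section Adjunctions.

Variable k : fieldType.
Implicit Types K L : kcat k.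

Definition nattrans_cast K L (F F' G G' : functor K L) (eF : F = F')
  (eG : G = G') (a : nattrans F G) : nattrans F' G'.
Proof.
refine (@NatTrans k K L F' G'
  (fun X => eqhom (eq_fob eG X) \oc a X \oc eqhom (esym (eq_fob eF X))) _).
case: F' / eF; case: G' / eG => X Y f /=.
by rewrite !comp1m !compm1 ncomp_natural.
Defined.

Definition left_adjoint K L (F : functor K L) (G : functor L K) :=
  exists (eta : nattrans (functor1 K) (functorM G F))
         (eps : nattrans (functorM F G) (functor1 L)),
    forall X, eps (F X) \oc fmor F (eta X) = idm (F X).

Lemma left_adjoint_epi K L (F : functor K L) (G : functor L K) :
  left_adjoint F G ->
  forall (X Y : K) (e : hom X Y), is_epi e -> is_epi (fmor F e).
Proof.
move=> [eta [eps tri]] X Y e epi_e Z u v euv.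
have transp (w : hom (F Y) Z) : w = eps Z \oc fmor F (fmor G w \oc eta Y).
  rewrite fmorM compA; have /= -> := ncomp_natural eps w.
  by rewrite -compA tri compm1.
rewrite (transp u) (transp v); congr (_ \oc fmor F _).
apply: epi_e; have /= en := ncomp_natural eta e.
by rewrite -!compA en !compA -!fmorM euv.
Qed.

Lemma left_adjoint_projective K L (F : functor K L) (G : functor L K) :
  left_adjoint F G ->
  (forall (X Y : L) (e : hom X Y), is_epi e -> is_epi (fmor G e)) ->
  forall P, projective P -> projective (F P).
Proof.
move=> [eta [eps tri]] Gepi P projP X Y e f epi_e.
have [g eg] := projP _ _ _ (fmor G f \oc eta P) (Gepi _ _ _ epi_e).
exists (eps X \oc fmor F g); rewrite compA.
have /= <- := ncomp_natural eps e.
rewrite -compA -fmorM eg fmorM compA; have /= -> := ncomp_natural eps f.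
by rewrite -compA tri compm1.
Qed.

End Adjunctions.

Section FiatAction.

Variables (k : fieldType) (C : twocat k) (M : tworep C).

Lemma tnat_eqhom (i j : C) (F G : hom1 C i j) (e : F = G) (X : M i) :
  tnat M (eqhom e) X = eqhom (congr1 (fun H => tfun M H X) e).
Proof. by case: G / e; rewrite tnat_idm. Qed.

Lemma tnat_hcompE (i j l : C) (G G' : hom1 C j l) (F F' : hom1 C i j)
    (b : hom G G') (a : hom F F') (X : M i) :
  tnat M (b \oh a) X
  = eqhom (esym (eq_fob (tfun_comp M G' F') X))
      \oc (tnat M b (tfun M F' X) \oc fmor (tfun M G) (tnat M a X)
        \oc eqhom (eq_fob (tfun_comp M G F) X)).
Proof.
by rewrite -tnat_hcomp compA eqhom_comp eqhom_id comp1m.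
Qed.

Let eqhom_compA (K : kcat k) (W X Y Z : K) (e : X = Y) (e' : Y = Z)
    (f : hom W X) :
  eqhom e' \oc (eqhom e \oc f) = eqhom (etrans e e') \oc f.
Proof. by rewrite compA eqhom_comp. Qed.

Lemma tfun_left_adjoint (i j : C) (F : hom1 C i j) (G : hom1 C j i)
    (alpha : hom (F \om G) (one1 j)) (beta : hom (one1 i) (G \om F)) :
  adjunction_morphisms alpha beta -> left_adjoint (tfun M F) (tfun M G).
Proof.
move=> [tri _].
exists (nattrans_cast (tfun_one M i) (tfun_comp M G F) (tnat M beta)).
exists (nattrans_cast (tfun_comp M F G) (tfun_one M j) (tnat M alpha)).
move=> X; rewrite -[RHS]tnat_idm -tri !tnat_comp !tnat_eqhom /=.
rewrite !tnat_hcompE !tnat_idm !fmor1 comp1m compm1 !fmorM !eqhom_fmor.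
rewrite -!compA !eqhom_compA !eqhom_comp.
apply: (congr2 comp (eqhom_irr _ _)); apply: (congr2 comp erefl).
apply: (congr2 comp (eqhom_irr _ _)); apply: (congr2 comp erefl).
exact: eqhom_irr.
Qed.

End FiatAction.

Section ProjectiveRepresentation.

Variables (k : fieldType) (C : twocat k) (fiatC : fiat C) (M : tworep C).

Lemma fiat_projective (i j : C) (F : hom1 C i j) (P : M i) :
  projective P -> projective (tfun M F P).
Proof.
have [_ _ _ _ _ [S adj]] := fiatC.
have [alpha [beta adjF]] := adj _ _ F.
apply: (left_adjoint_projective (tfun_left_adjoint M adjF)).
have [alpha' [beta' adjF']] := adj _ _ (dual S F).
exact: (left_adjoint_epi (tfun_left_adjoint M adjF')).
Qed.

Definition pr_cat (i : C) : kcat k := fullsub (@projective k (M i)).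

Definition pr_fun (i j : C) (F : hom1 C i j) : functor (pr_cat i) (pr_cat j) :=
  functor_restr (@fiat_projective i j F).

Definition pr_nat (i j : C) (F G : hom1 C i j) (a : hom F G) :
    nattrans (pr_fun F) (pr_fun G) :=
  nattrans_restr (@fiat_projective i j F) (@fiat_projective i j G) (tnat M a).

Lemma pr_fun_one (i : C) : pr_fun (one1 i) = functor1 (pr_cat i).
Proof.
have e (X : pr_cat i) : pr_fun (one1 i) X = X.
  by apply: fullsub_ext; exact: (eq_fob (tfun_one M i) (sval X)).
apply: (@functor_ext _ _ _ (pr_fun (one1 i)) (functor1 _) e) => X Y f.
have := eq_fmor (tfun_one M i) f.
by rewrite -!(eqhom_fullsub (e _)).
Qed.

Lemma pr_fun_comp (i j l : C) (G : hom1 C j l) (F : hom1 C i j) :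
  pr_fun (G \om F) = functorM (pr_fun G) (pr_fun F).
Proof.
have e (X : pr_cat i) : pr_fun (G \om F) X = pr_fun G (pr_fun F X).
  by apply: fullsub_ext; exact: (eq_fob (tfun_comp M G F) (sval X)).
apply: (@functor_ext _ _ _ (pr_fun (G \om F)) (functorM _ _) e) => X Y f.
have := eq_fmor (tfun_comp M G F) f.
by rewrite -!(eqhom_fullsub (e _)).
Qed.

Definition pr_rep : tworep C.
Proof.
refine (@TwoRep k C pr_cat pr_fun pr_nat _ _ pr_fun_one pr_fun_comp _).
- by move=> i j F X; exact: tnat_idm.
- by move=> i j F G H b a X; exact: tnat_comp.
- move=> i j l G G' F F' b a X.
  have := tnat_hcomp b a (sval X).
  by rewrite -(eqhom_fullsub (eq_fob (pr_fun_comp G F) X))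
    -(eqhom_fullsub (eq_fob (pr_fun_comp G' F') X)).
Defined.

End ProjectiveRepresentation.

Section AbelianizationRepresentation.

Variables (k : fieldType) (C : twocat k) (N : tworep C).

Lemma ab_fun_one (i : C) : abfunctor (tfun N (one1 i)) = functor1 (abcat (N i)).
Proof.
have e (A : abcat (N i)) : abfunctor (tfun N (one1 i)) A = A.
  apply: (@arrow_ext k (N i) (arrow_map _ A) A
    (eq_fob (tfun_one N i) _) (eq_fob (tfun_one N i) _)).
  exact: (eq_fmor (tfun_one N i) (amap A)).
apply: (@functor_ext _ _ _ (abfunctor (tfun N (one1 i))) (functor1 _) e) => A B f.
have [s es ->] := eqhom_abcat (e A) (eq_fob (tfun_one N i) (atgt A)).
have [t et ->] := eqhom_abcat (e B) (eq_fob (tfun_one N i) (atgt B)).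
elim/abpi_ind: f => f; rewrite -[LHS]/(abcomp _ _) -[RHS]/(abcomp _ _) /=.
rewrite abmap_pi !abcomp_pi; apply: (@abpi_eq k (N i) (arrow_map _ A) B) => /=.
by rewrite es et; exact: (eq_fmor (tfun_one N i)).
Qed.

Lemma ab_fun_comp (i j l : C) (G : hom1 C j l) (F : hom1 C i j) :
  abfunctor (tfun N (G \om F))
  = functorM (abfunctor (tfun N G)) (abfunctor (tfun N F)).
Proof.
have e (A : abcat (N i)) : abfunctor (tfun N (G \om F)) A
    = abfunctor (tfun N G) (abfunctor (tfun N F) A).
  apply: (@arrow_ext k (N l) (arrow_map _ A) (arrow_map _ (arrow_map _ A))
    (eq_fob (tfun_comp N G F) _) (eq_fob (tfun_comp N G F) _)).
  exact: (eq_fmor (tfun_comp N G F) (amap A)).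
apply: (@functor_ext _ _ _ (abfunctor (tfun N (G \om F)))
  (functorM _ _) e) => A B f.
have [s es ->] := eqhom_abcat (e A) (eq_fob (tfun_comp N G F) (atgt A)).
have [t et ->] := eqhom_abcat (e B) (eq_fob (tfun_comp N G F) (atgt B)).
elim/abpi_ind: f => f; rewrite -[LHS]/(abcomp _ _) -[RHS]/(abcomp _ _) /=.
rewrite !abmap_pi !abcomp_pi.
apply: (@abpi_eq k (N l) (arrow_map _ A) (arrow_map _ (arrow_map _ B))) => /=.
by rewrite es et; exact: (eq_fmor (tfun_comp N G F)).
Qed.

Definition abelianization : tworep C.
Proof.
refine (@TwoRep k C (fun i => abcat (N i))
  (fun i j F => abfunctor (tfun N F))
  (fun i j F G a => abnattrans (tnat N a)) _ _ ab_fun_one ab_fun_comp _).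
- move=> i j F A; by apply: (@abpi_eq k (N j) (arrow_map _ A) (arrow_map _ A)); exact: tnat_idm.
- move=> i j F G H b a A; rewrite -[RHS]/(abcomp _ _) /= abcomp_pi.
  by apply: (@abpi_eq k (N j) (arrow_map _ A) (arrow_map _ A)); exact: tnat_comp.
- move=> i j l G G' F F' b a A.
  have [s es ->] := eqhom_abcat (eq_fob (ab_fun_comp G F) A)
    (eq_fob (tfun_comp N G F) (atgt A)).
  have [t et ->] := eqhom_abcat (eq_fob (ab_fun_comp G' F') A)
    (eq_fob (tfun_comp N G' F') (atgt A)).
  rewrite -[LHS]/(abcomp _ _) -[RHS]/(abcomp (abcomp _ _) _) /=.
  rewrite !abmap_pi !abcomp_pi.
  apply: (@abpi_eq k (N l) (arrow_map _ A) (arrow_map _ (arrow_map _ A))) => /=.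
  by rewrite es et; exact: tnat_hcomp.
Defined.

End AbelianizationRepresentation.

(* Main.v *)
From HB Require Import structures.
From mathcomp Require Import all_boot all_algebra.
From mathcomp Require Import boolp.
Require Import Defs.

(** No strict transformation between M and the abelianization of M_pr is
    apparent: sending an arrow of projectives to its cokernel requires a choice
    of cokernels, which the action of C respects only up to isomorphism.  The
    two are joined through a third 2-representation in which the choice is part
    of the data.  An object of [pres_rep] over i is an arrow P1 -> P0 of
    projectives of M i together with an object X and a cokernel P0 -> X of that
    arrow; its morphisms are those of the underlying arrows in the
    abelianization.  Every 1-morphism of C acts as a left adjoint, hence
    preserves cokernels, and so acts on such triples component by component.
    Forgetting X, or keeping only X, commutes with the action on the nose: this
    gives strict transformations from [pres_rep] to the abelianization of M_pr
    and to M.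

    Both are equivalences over each object because M i is a module category.
    The first is fully faithful by construction, and surjective on objects since
    arrows of modules have cokernels ([equivalence_cokernel]).  The second is
    essentially surjective since every module has a projective presentation
    ([equivalence_presentation]).  It is fully faithful by the usual comparison
    of projective resolutions: a map of cokernels lifts to P0 -> P0' since P0 is
    projective, then to a commutative square since P1 is, and a square inducing
    zero is null-homotopic.  The last two steps use that a map from a projective
    to P0' killed by the cokernel map factors through P1'
    ([equivalence_exact]).

    These three properties are proved for modules over a finite dimensional
    algebra, where epimorphisms are the surjections, and carried to M i along an
    equivalence, which is a left adjoint in both directions. *)

Set Implicit Arguments.
Unset Strict Implicit.
Unset Printing Implicit Defensive.

Import GRing.Theory.
Local Open Scope ring_scope.
Local Open Scope twocat_scope.

(** * Cokernels and left adjoints *)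

Section Cokernels.

Variable k : fieldType.
Implicit Types K L : kcat k.

(** Uniqueness of the factorization is stated as the epi condition. *)
Definition is_cokernel K (X Y Z : K) (f : hom X Y) (p : hom Y Z) :=
  [/\ p \oc f = 0, is_epi p
    & forall W (h : hom Y W), h \oc f = 0 -> exists t, h = t \oc p].

(** A map killing F f is transposed to one killing f, factored through p there,
    and transposed back. *)
Lemma left_adjoint_cokernel K L (F : functor K L) (G : functor L K) :
  left_adjoint F G -> forall (X Y Z : K) (f : hom X Y) (p : hom Y Z),
  is_cokernel f p -> is_cokernel (fmor F f) (fmor F p).
Proof.
move=> adj X Y Z f p [pf epi_p cok]; split.
- by rewrite -fmorM pf fmor0.
- exact: (left_adjoint_epi adj).
move: adj => [eta [eps tri]] W h hf.
have [|t et] := cok _ (fmor G h \oc eta Y).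
  rewrite -compA; have /= -> := ncomp_natural eta f.
  by rewrite compA -fmorM hf fmor0 comp0m.
exists (eps W \oc fmor F t); rewrite -compA -fmorM -et fmorM compA.
by have /= -> := ncomp_natural eps h; rewrite -compA tri compm1.
Qed.

Lemma cokernel_iso_target K (X Y Z Z' : K) (f : hom X Y) (p : hom Y Z)
    (i : hom Z Z') :
  is_iso i -> is_cokernel f p -> is_cokernel f (i \oc p).
Proof.
move=> [j [ji ij]] [pf epi_p cok]; split.
- by rewrite -compA pf compm0.
- move=> W u v; rewrite !compA => /epi_p uv.
  by rewrite -[u]compm1 -[v]compm1 -ij !compA uv.
move=> W h /cok[t ->]; exists (t \oc j).
by rewrite -compA [j \oc _]compA ji comp1m.
Qed.

Lemma cokernel_iso_source K (X Y X' Y' Z : K) (f : hom X Y) (f' : hom X' Y')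
    (p : hom Y' Z) (i : hom X X') (j : hom Y Y') :
  is_iso i -> is_iso j -> j \oc f = f' \oc i ->
  is_cokernel f' p -> is_cokernel f (p \oc j).
Proof.
move=> [i' [i'i ii']] [j' [j'j jj']] e [pf epi_p cok]; split.
- by rewrite -compA e compA pf comp0m.
- move=> W u v; rewrite !compA => uv; apply: epi_p.
  by rewrite -[u \oc p]compm1 -[v \oc p]compm1 -jj' !compA uv.
move=> W h hf; have [|t et] := cok _ (h \oc j'); last first.
  by exists t; rewrite compA -et -compA j'j compm1.
rewrite -[f']compm1 -ii' [f' \oc _]compA -e -!compA [j' \oc _]compA j'j comp1m.
by rewrite compA hf comp0m.
Qed.

End Cokernels.

(** * Equivalences of linear categories *)

Section Equivalences.

Variable k : fieldType.
Implicit Types K L : kcat k.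

Lemma nattrans_inverse K L (F G : functor K L) (a : nattrans F G) :
  (forall X, is_iso (a X)) -> exists b : nattrans G F,
    forall X, b X \oc a X = idm (F X) /\ a X \oc b X = idm (G X).
Proof.
move=> iso_a; pose b X := sval (cid (iso_a X)).
have bP X : b X \oc a X = idm (F X) /\ a X \oc b X = idm (G X).
  exact: (svalP (cid (iso_a X))).
have nat X Y (f : hom X Y) : b Y \oc fmor G f = fmor F f \oc b X.
  rewrite -[LHS]compm1 -(bP X).2 -compA [fmor G f \oc _]compA.
  by rewrite -ncomp_natural -compA compA (bP Y).1 comp1m.
by exists (NatTrans nat).
Qed.

(** The data of an equivalence need not satisfy a triangle identity, so the
    counit eps is replaced by c = eps . E(eta_G) . eps'_(EG), which satisfies it
    together with the unit eta'.  The hypotheses are symmetric in E and G, up to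
    exchanging eta and eps, so G is also left adjoint to E. *)
Lemma equivalence_left_adjoint K L (E : functor K L) (G : functor L K)
    (eta : nattrans (functorM G E) (functor1 K))
    (eps : nattrans (functorM E G) (functor1 L)) :
  (forall X, is_iso (eta X)) -> (forall Y, is_iso (eps Y)) -> left_adjoint E G.
Proof.
move=> /nattrans_inverse[eta' etaK] /nattrans_inverse[eps' epsK].
pose c Y : hom (functorM E G Y) (functor1 L Y) :=
  eps Y \oc fmor E (eta (G Y)) \oc eps' (E (G Y)).
have nat X Y (f : hom X Y) :
    c Y \oc fmor (functorM E G) f = fmor (functor1 L) f \oc c X.
  rewrite /c /= -!compA; have /= -> := ncomp_natural eps' (fmor E (fmor G f)).
  rewrite [fmor E _ \oc _]compA -fmorM.
  have /= -> := ncomp_natural eta (fmor G f).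
  by rewrite fmorM !compA; have /= -> := ncomp_natural eps f.
exists eta', (NatTrans nat) => X /=.
rewrite /c /= -compA; have /= -> := ncomp_natural eps' (fmor E (eta' X)).
rewrite compA -[eps _ \oc _ \oc _]compA -fmorM.
have /= -> := ncomp_natural eta (eta' X).
by rewrite (etaK X).1 fmor1 compm1 (epsK _).2.
Qed.

Lemma is_equivalence_comp K L (M : kcat k) (F : functor K L) (G : functor L M) :
  is_equivalence F -> is_equivalence G -> is_equivalence (functorM G F).
Proof.
move=> [F' [eta [eps [iso_eta iso_eps]]]].
move=> [G' [eta' [eps' [iso_eta' iso_eps']]]].
have iso_fmor (K1 K2 : kcat k) (H : functor K1 K2) (X Y : K1) (f : hom X Y) :
    is_iso f -> is_iso (fmor H f).
  by move=> [g [gf fg]]; exists (fmor H g); rewrite -!fmorM gf fg !fmor1.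
have iso_comp (K1 : kcat k) (X Y Z : K1) (g : hom Y Z) (f : hom X Y) :
    is_iso g -> is_iso f -> is_iso (g \oc f).
  move=> [g' [g'g gg']] [f' [f'f ff']]; exists (f' \oc g'); split.
    by rewrite -compA [g' \oc _]compA g'g comp1m.
  by rewrite -compA [f \oc _]compA ff' comp1m.
have nat1 X Y (f : hom X Y) :
    (eta Y \oc fmor F' (eta' (F Y)))
      \oc fmor (functorM (functorM F' G') (functorM G F)) f
    = fmor (functor1 K) f \oc (eta X \oc fmor F' (eta' (F X))).
  rewrite /= -compA -fmorM; have /= -> := ncomp_natural eta' (fmor F f).
  by rewrite fmorM !compA; have /= -> := ncomp_natural eta f.
have nat2 X Y (f : hom X Y) :
    (eps' Y \oc fmor G (eps (G' Y)))
      \oc fmor (functorM (functorM G F) (functorM F' G')) f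
    = fmor (functor1 M) f \oc (eps' X \oc fmor G (eps (G' X))).
  rewrite /= -compA -fmorM; have /= -> := ncomp_natural eps (fmor G' f).
  by rewrite fmorM !compA; have /= -> := ncomp_natural eps' f.
exists (functorM F' G'),
  (@NatTrans _ _ _ (functorM (functorM F' G') (functorM G F)) (functor1 K) _
    nat1),
  (@NatTrans _ _ _ (functorM (functorM G F) (functorM F' G')) (functor1 M) _
    nat2).
split=> X.
  apply: (iso_comp _ _ _ _ _ _ (iso_eta X)).
  exact: (iso_fmor _ _ F' _ _ _ (iso_eta' (F X))).
apply: (iso_comp _ _ _ _ _ _ (iso_eps' X)).
exact: (iso_fmor _ _ G _ _ _ (iso_eps (G' X))).
Qed.

Lemma is_equivalence_inverse K L (F : functor K L) :
  is_equivalence F -> exists G : functor L K, is_equivalence G.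
Proof. by move=> [G [eta [eps [ieta ieps]]]]; exists G, F, eps, eta. Qed.

Lemma fully_faithful_is_equivalence K L (F : functor K L) :
  (forall (X Y : K) (f g : hom X Y), fmor F f = fmor F g -> f = g) ->
  (forall (X Y : K) (h : hom (F X) (F Y)), exists f, fmor F f = h) ->
  (forall Y : L, exists X : K, isomorphic (F X) Y) ->
  is_equivalence F.
Proof.
move=> inj_F full_F surj_F.
pose o Y : K := sval (cid (surj_F Y)).
have isoP Y : {s : hom (F (o Y)) Y * hom Y (F (o Y)) |
    s.2 \oc s.1 = idm _ /\ s.1 \oc s.2 = idm _}.
  apply: cid; have [s [s' sP]] := svalP (cid (surj_F Y)).
  by exists (s, s').
pose s Y := (sval (isoP Y)).1; pose s' Y := (sval (isoP Y)).2.
have s's Y : s' Y \oc s Y = idm _ := (svalP (isoP Y)).1.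
have ss' Y : s Y \oc s' Y = idm _ := (svalP (isoP Y)).2.
pose lift X Y (h : hom (F X) (F Y)) : hom X Y := sval (cid (full_F _ _ h)).
have liftK X Y (h : hom (F X) (F Y)) : fmor F (lift _ _ h) = h.
  exact: (svalP (cid (full_F _ _ h))).
pose Gm X Y (g : hom X Y) : hom (o X) (o Y) := lift _ _ (s' Y \oc g \oc s X).
have Gm1 X : Gm X X (idm X) = idm (o X).
  by apply: inj_F; rewrite liftK fmor1 compm1 s's.
have GmM X Y Z (g : hom Y Z) (f : hom X Y) :
    Gm X Z (g \oc f) = Gm Y Z g \oc Gm X Y f.
  apply: inj_F; rewrite fmorM !liftK -!compA; congr (_ \oc (_ \oc _)).
  by rewrite compA ss' comp1m.
have GmL X Y : linear (Gm X Y).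
  move=> a f g; apply: inj_F; rewrite fmorD fmorZ !liftK.
  by rewrite compmD compDm compmZ compZm.
pose G := Functor Gm1 GmM GmL.
have nat1 X Y (f : hom X Y) : lift _ _ (s (F Y)) \oc fmor (functorM G F) f
    = fmor (functor1 K) f \oc lift _ _ (s (F X)).
  by apply: inj_F; rewrite /= !fmorM !liftK !compA ss' comp1m.
have nat2 X Y (f : hom X Y) :
    s Y \oc fmor (functorM F G) f = fmor (functor1 L) f \oc s X.
  by rewrite /= liftK !compA ss' comp1m.
exists G, (@NatTrans _ _ _ (functorM G F) (functor1 K) _ nat1),
  (@NatTrans _ _ _ (functorM F G) (functor1 L) _ nat2); split=> [X|Y] /=.
  exists (lift _ _ (s' (F X))); split; apply: inj_F;
  by rewrite fmorM !liftK fmor1.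
by exists (s' Y).
Qed.

End Equivalences.

(** * Modules over a finite dimensional algebra *)

Lemma linear_hom (k : fieldType) (V W : vectType k) (f : V -> W) :
  linear f -> {g : 'Hom(V, W) | forall v, g v = f v}.
Proof.
move=> lin_f; pose L := GRing.isLinear.Build k V W _ f lin_f.
pose f' : {linear V -> W} := HB.pack f L.
by exists (linfun f') => v; rewrite lfunE.
Qed.

Section Modules.

Variables (k : fieldType) (A : fdalgebra k).
Implicit Types V W : modcat A.

Lemma module_hom_act V W (f : hom V W) a (v : mcar V) :
  val f (mact V a v) = mact W a (val f v).
Proof. by have /lfunP/(_ v) := module_homP f a; rewrite !comp_lfunE. Qed.

Lemma module_hom_of_linear V W (f : 'Hom(mcar V, mcar W)) :
  (forall a v, f (mact V a v) = mact W a (f v)) ->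
  {g : hom V W | val g = f}.
Proof.
move=> fa; have e a : (f \o mact V a = mact W a \o f)%VF.
  by apply/lfunP => v; rewrite !comp_lfunE fa.
by exists (mk_module_hom e).
Qed.

Lemma module_hom_ext V W (f g : hom V W) :
  (forall v, val f v = val g v) -> f = g.
Proof. by move=> e; apply: val_inj; apply/lfunP. Qed.

Lemma module_comp_val (U V W : modcat A) (g : hom V W) (f : hom U V) u :
  val (g \oc f) u = val g (val f u).
Proof. by rewrite /= comp_lfunE. Qed.

Lemma mact_comp V a b (v : mcar V) :
  mact V (amul a b) v = mact V a (mact V b v).
Proof. by rewrite mact_mul comp_lfunE. Qed.

Lemma mact_1 V (v : mcar V) : mact V (aone A) v = v.
Proof. by rewrite mact_one id_lfunE. Qed.

Lemma mactP V c a b (v : mcar V) :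
  mact V (c *: a + b) v = c *: mact V a v + mact V b v.
Proof. by rewrite mact_linear !lfunE /= !lfunE. Qed.

Definition surjective V W (f : hom V W) := forall w, exists v, w = val f v.

Definition stable V (U : {vspace mcar V}) :=
  forall a v, v \in U -> mact V a v \in U.

Lemma stable_limg V W (f : hom V W) : @stable W (limg (val f)).
Proof.
move=> a _ /memv_imgP[v _ ->]; rewrite -module_hom_act.
exact/memv_img/memvf.
Qed.

Lemma stable_lker V W (f : hom V W) : @stable V (lker (val f)).
Proof.
by move=> a v; rewrite !memv_ker module_hom_act => /eqP ->; rewrite linear0.
Qed.

(** A linear retract W of V inherits the compressed action p a i as soon as
    compression is multiplicative.  Submodules and quotients both arise in this
    way, a quotient being realized on a linear complement. *)
Lemma retract_module V (W : vectType k) (i : 'Hom(W, mcar V))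
    (p : 'Hom(mcar V, W)) :
  (forall w, p (i w) = w) ->
  (forall a b w, p (mact V a (i (p (mact V b (i w)))))
                 = p (mact V a (mact V b (i w)))) ->
  exists (X : modcat A) (j : 'Hom(mcar X, mcar V)) (q : 'Hom(mcar V, mcar X)),
    [/\ forall w, q (j w) = w,
        forall v, j (q v) = i (p v)
      & forall a w, mact X a w = q (mact V a (j w))].
Proof.
move=> pi stab; pose act a : 'End(W) := (p \o mact V a \o i)%VF.
have actE a w : act a w = p (mact V a (i w)) by rewrite !comp_lfunE.
have actL : linear act.
  move=> c a b; apply/lfunP => w.
  by rewrite !lfunE /= !lfunE /= !lfunE /= !lfunE /= mactP linearP.
have act1 : act (aone A) = \1%VF.
  by apply/lfunP => w; rewrite actE mact_1 pi id_lfunE.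
have actM a b : act (amul a b) = (act a \o act b)%VF.
  by apply/lfunP => w; rewrite comp_lfunE !actE stab mact_comp.
by exists (FdModule actL act1 actM), i, p; split.
Qed.

Lemma submodule_exists V (U : {vspace mcar V}) : stable U ->
  exists (W : modcat A) (j : hom W V),
    injective (val j) /\ limg (val j) = U.
Proof.
move=> stabU; have [i iE] := linear_hom (@linearP _ _ _ _ (@vsval _ _ U)).
have [p pE] := linear_hom (@linearP _ _ _ _ (@vsproj _ _ U)).
have pi w : p (i w) = w by rewrite iE pE /= vsvalK.
have ipU v : v \in U -> i (p v) = v by move=> Uv; rewrite iE pE /= vsprojK.
have iU w : i w \in U by rewrite iE /= subvsP.
have [|X [j [q [qj jq actX]]]] := retract_module pi.
  by move=> a b w; rewrite ipU // stabU.
have jU w : j w \in U by rewrite -[w]qj jq.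
have [|f fE] := @module_hom_of_linear X V j.
  by move=> a w; rewrite actX jq ipU // stabU.
exists X, f; rewrite fE; split; first exact: can_inj qj.
apply/vspaceP => v; apply/memv_imgP/idP => [[w _ ->] //|Uv].
by exists (q v); rewrite ?memvf // jq ipU.
Qed.

Lemma quotient_module V (U : {vspace mcar V}) : stable U ->
  exists (W : modcat A) (q : hom V W),
    surjective q /\ lker (val q) = U.
Proof.
(* v |-> v - projv U v projects onto the complement K of U, with kernel U. *)
move=> stabU; pose K := lker (projv U).
have [i iE] := linear_hom (@linearP _ _ _ _ (@vsval _ _ K)).
have [p pE] : {p : 'Hom(mcar V, subvs_of K) |
    forall v, p v = vsproj K (v - projv U v)}.
  apply: linear_hom => c u v.
  by rewrite [projv U _]linearP opprD addrACA -scalerBr linearP.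
have KB v : v - projv U v \in K.
  by rewrite memv_ker linearB /= projv_proj subrr.
have ip v : i (p v) = v - projv U v by rewrite iE pE /= vsprojK.
have pi w : p (i w) = w.
  have /eqP w0 : projv U (vsval w) == 0 by rewrite -memv_ker subvsP.
  by rewrite pE iE /= w0 subr0 vsvalK.
have p0 v : (p v == 0) = (v \in U).
  apply/eqP/idP => [pv0|Uv]; last by rewrite pE projv_id // subrr linear0.
  have /eqP := ip v; rewrite pv0 linear0 eq_sym subr_eq0 => /eqP ->.
  exact: memv_proj.
have [|X [j [q [qj jq actX]]]] := retract_module pi.
  move=> a b w; rewrite ip !linearB /=; apply/eqP.
  rewrite subr_eq addrC -subr_eq.
  by rewrite subrr eq_sym p0 stabU // memv_proj.
have q0 v : q v = 0 <-> v \in U.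
  rewrite -p0; split=> [e|/eqP e]; first apply/eqP.
    by rewrite -[p v]pi -jq e !linear0.
  by rewrite -[q v]qj jq e !linear0.
have [|f fE] := @module_hom_of_linear V X q.
  move=> a v; rewrite actX; apply/eqP; rewrite -subr_eq0.
  have -> (x y : mcar V) : q x - q y = q (x - y) by rewrite linearB.
  have -> (x y : mcar V) : mact V a x - mact V a y = mact V a (x - y).
    by rewrite linearB.
  apply/eqP/q0/stabU.
  by rewrite jq ip opprB addrC subrK memv_proj.
have fq v : val f v = q v by rewrite fE.
exists X, f; split=> [w|]; first by exists (j w); rewrite fq.
apply/vspaceP => v; rewrite memv_ker fq.
by apply/eqP/idP => /q0.
Qed.

Lemma surjective_factor V W X (q : hom V W) (h : hom V X) :
  surjective q -> (lker (val q) <= lker (val h))%VS -> exists t, h = t \oc q.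
Proof.
move=> surj_q /subvP ker_qh; pose t := (val h \o (val q)^-1)%VF.
have tq v : t (val q v) = val h v.
  apply/eqP; rewrite comp_lfunE -subr_eq0 -linearB -memv_ker; apply: ker_qh.
  rewrite memv_ker linearB /= limg_lfunVK ?subrr //; exact/memv_img/memvf.
have [|f fE] := @module_hom_of_linear W X t.
  move=> a w; have [v ->] := surj_q w.
  by rewrite -module_hom_act !tq module_hom_act.
by exists f; apply: module_hom_ext => v; rewrite module_comp_val fE tq.
Qed.

Lemma injective_factor V W X (j : hom W V) (g : hom X V) :
  injective (val j) -> (limg (val g) <= limg (val j))%VS ->
  exists t, g = j \oc t.
Proof.
move=> inj_j /subvP img_gj; pose t := ((val j)^-1 \o val g)%VF.
have jt v : val j (t v) = val g v.
  by rewrite comp_lfunE limg_lfunVK // img_gj // memv_img // memvf.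
have [|f fE] := @module_hom_of_linear X W t.
  by move=> a v; apply: inj_j; rewrite module_hom_act !jt module_hom_act.
by exists f; apply: module_hom_ext => v; rewrite module_comp_val fE jt.
Qed.

Lemma surjective_epi V W (e : hom V W) : surjective e -> is_epi e.
Proof.
move=> surj_e X f g efg; apply: module_hom_ext => w; have [v ->] := surj_e w.
by rewrite -!module_comp_val efg.
Qed.

Lemma surjective_cokernel V W X (f : hom X V) (q : hom V W) :
  surjective q -> lker (val q) = limg (val f) -> is_cokernel f q.
Proof.
move=> surj_q ker_q; split; [|exact: surjective_epi|].
  apply: module_hom_ext => x; rewrite module_comp_val lfunE /=.
  by apply/eqP; rewrite -memv_ker ker_q memv_img ?memvf.
move=> Y h hf; apply: surjective_factor => //; rewrite ker_q.
apply/subvP => _ /memv_imgP[x _ ->].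
by rewrite memv_ker -module_comp_val hf lfunE.
Qed.

Lemma modcat_cokernel V W (f : hom V W) :
  exists (X : modcat A) (p : hom W X), is_cokernel f p.
Proof.
have [X [p [surj_p ker_p]]] := quotient_module (@stable_limg _ _ f).
by exists X, p; apply: surjective_cokernel.
Qed.

(** The quotient map by the image of e has the same composite with e as 0. *)
Lemma epi_surjective V W (e : hom V W) : is_epi e -> surjective e.
Proof.
have [X [p [_ ker_p]]] := quotient_module (@stable_limg _ _ e).
move=> epi_e w; have p0 : p = 0.
  apply: epi_e; rewrite comp0m; apply: module_hom_ext => v.
  rewrite module_comp_val lfunE /=.
  by apply/eqP; rewrite -memv_ker ker_p memv_img ?memvf.
have : w \in lker (val p) by rewrite memv_ker p0 lfunE.
by rewrite ker_p => /memv_imgP[v _ ->]; exists v.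
Qed.

(** Comparing p with the quotient map by the image of f shows that g takes
    values in that image, over which f is surjective; projectivity of P then
    lifts g. *)
Lemma modcat_exact (P P1 P0 X : modcat A) (f : hom P1 P0) (p : hom P0 X)
    (g : hom P P0) :
  is_cokernel f p -> projective P -> p \oc g = 0 -> exists h, f \oc h = g.
Proof.
move=> [_ _ cok] projP pg.
have [Y [q [_ ker_q]]] := quotient_module (@stable_limg _ _ f).
have [|t qt] := cok _ q.
  apply: module_hom_ext => v; rewrite module_comp_val lfunE /=.
  by apply/eqP; rewrite -memv_ker ker_q memv_img ?memvf.
have [W [j [inj_j img_j]]] := submodule_exists (@stable_limg _ _ f).
have [|g' ->] := @injective_factor _ _ _ j g inj_j.
  rewrite img_j -ker_q; apply/subvP => _ /memv_imgP[x _ ->].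
  by rewrite memv_ker -module_comp_val qt -compA pg compm0 lfunE.
have [|f' ef] := @injective_factor _ _ _ j f inj_j; first by rewrite img_j.
have [|h <-] := projP _ _ f' g'.
  apply: surjective_epi => w.
  have : val j w \in limg (val f) by rewrite -img_j memv_img ?memvf.
  move=> /memv_imgP[v _]; rewrite ef module_comp_val => /inj_j ->.
  by exists v.
by exists h; rewrite compA -ef.
Qed.

(** The module A^n, with the action on each coordinate.  The second property is
    the map sending the standard basis to any given x; it makes A^n surject onto
    every module generated by n elements. *)
Lemma free_module_exists n : exists (P : modcat A), projective P /\
  forall V (x : 'I_n -> mcar V), exists f : hom P V,
    forall a : 'I_n -> acar A, exists u, val f u = \sum_i mact V (a i) (x i).
Proof.
pose act a (u : {ffun 'I_n -> acar A}) := [ffun i => amul a (u i)].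
have actl a : linear (act a).
  by move=> c u v; apply/ffunP => i; rewrite !ffunE amul_linearr.
pose actf a := sval (linear_hom (actl a)).
have actE a u : actf a u = [ffun i => amul a (u i)].
  exact: (svalP (linear_hom (actl a))).
have actL : linear actf.
  move=> c a b; apply/lfunP => u; rewrite !lfunE /= !lfunE /= !actE.
  by apply/ffunP => i; rewrite !ffunE amul_linearl.
have act1 : actf (aone A) = \1%VF.
  apply/lfunP => u; rewrite actE id_lfunE.
  by apply/ffunP => i; rewrite !ffunE amul1l.
have actM a b : actf (amul a b) = (actf a \o actf b)%VF.
  apply/lfunP => u; rewrite comp_lfunE !actE.
  by apply/ffunP => i; rewrite !ffunE amulA.
pose P : modcat A := FdModule actL act1 actM.
have lift V (x : 'I_n -> mcar V) : {f : hom P V |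
    forall u : {ffun 'I_n -> acar A}, val f u = \sum_i mact V (u i) (x i)}.
  have [|f fE] := @linear_hom k {ffun 'I_n -> acar A} (mcar V)
      (fun u => \sum_i mact V (u i) (x i)).
    move=> c u v; rewrite scaler_sumr -big_split; apply: eq_bigr => i _.
    by rewrite !ffunE mactP.
  have [|g gE] := @module_hom_of_linear P V f; last by exists g; rewrite gE.
  move=> a u; rewrite !fE linear_sum; apply: eq_bigr => i _ /=.
  by rewrite actE ffunE mact_comp.
exists P; split=> [X Y e f epi_e|V x]; last first.
  have [f fE] := lift V x; exists f => a; exists [ffun i => a i]; rewrite fE.
  by apply: eq_bigr => i _; rewrite ffunE.
pose delta i : {ffun 'I_n -> acar A} :=
  [ffun j => if j == i then aone A else 0].
have deltaE (u : {ffun 'I_n -> acar A}) :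
    u = \sum_i mact P (u i) (delta i).
  apply/ffunP => j; rewrite sum_ffunE (bigD1 j) //= actE !ffunE eqxx amul1r.
  rewrite big1 ?addr0 // => i /negPf ij; rewrite actE !ffunE eq_sym ij.
  by have := amul_linearr (u i) (-1) 0 0; rewrite scaler0 addr0 scaleN1r addNr.
pose x i : mcar X := sval (cid (epi_surjective epi_e (val f (delta i)))).
have xE i : val f (delta i) = val e (x i).
  exact: (svalP (cid (epi_surjective epi_e (val f (delta i))))).
have [g gE] := lift X x; exists g; apply: module_hom_ext => u.
rewrite module_comp_val gE [in RHS](deltaE u) !linear_sum.
apply: eq_bigr => i _ /=; rewrite module_hom_act -xE; symmetry.
exact: (module_hom_act f).
Qed.

Lemma modcat_enough_projectives V :
  exists (P : modcat A) (p : hom P V), projective P /\ surjective p.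
Proof.
have [P [projP liftP]] := free_module_exists (\dim {: mcar V}).
have [f fP] := liftP V (fun i => (vbasis {: mcar V})`_i).
exists P, f; split=> // v.
have [u fu] := fP (fun i => coord (vbasis {: mcar V}) i v *: aone A).
exists u; rewrite fu {1}(coord_vbasis (memvf v)); apply: eq_bigr => i _.
rewrite -[X in mact _ X]addr0 mactP mact_1.
by have := mactP (-1) 0 0 (vbasis {: mcar V})`_i;
  rewrite scaler0 addr0 scaleN1r addNr => ->; rewrite addr0.
Qed.

(** Cover V by a projective, then cover the kernel of that map by another. *)
Lemma modcat_presentation V :
  exists (P1 P0 : modcat A) (f : hom P1 P0) (p : hom P0 V),
    [/\ projective P1, projective P0 & is_cokernel f p].
Proof.
have [P0 [p [proj0 surj_p]]] := modcat_enough_projectives V.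
have [W [j [_ img_j]]] := submodule_exists (@stable_lker _ _ p).
have [P1 [q [proj1 surj_q]]] := modcat_enough_projectives W.
exists P1, P0, (j \oc q), p; split=> //; apply: surjective_cokernel => //.
rewrite -img_j; apply/vspaceP => v; apply/memv_imgP/memv_imgP => -[w _ ->].
  by have [u ->] := surj_q w; exists u; rewrite ?memvf // module_comp_val.
by exists (val q w); rewrite ?memvf // module_comp_val.
Qed.

End Modules.

(** * Transport along an equivalence with a module category *)

Section EquivalentToModules.

Variables (k : fieldType) (K : kcat k) (A : fdalgebra k).
Variable E : functor K (modcat A).
Hypothesis eqvE : is_equivalence E.

Lemma equivalence_cokernel (X Y : K) (f : hom X Y) :
  exists (Z : K) (p : hom Y Z), is_cokernel f p.
Proof.
have [G [eta [eps [iso_eta iso_eps]]]] := eqvE.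
have adjG := equivalence_left_adjoint iso_eps iso_eta.
have [eta' etaK] := nattrans_inverse iso_eta.
have [Z [p cok]] := modcat_cokernel (fmor E f).
exists (G Z), (fmor G p \oc eta' Y).
apply: (cokernel_iso_source (f' := fmor G (fmor E f)) (i := eta' X)).
- by exists (eta X); have [] := etaK X.
- by exists (eta Y); have [] := etaK Y.
- exact: (ncomp_natural eta').
exact: left_adjoint_cokernel adjG _ _ _ _ _ cok.
Qed.

Lemma equivalence_presentation (X : K) :
  exists (P1 P0 : K) (f : hom P1 P0) (p : hom P0 X),
    [/\ projective P1, projective P0 & is_cokernel f p].
Proof.
have [G [eta [eps [iso_eta iso_eps]]]] := eqvE.
have adjG := equivalence_left_adjoint iso_eps iso_eta.
have epiE := left_adjoint_epi (equivalence_left_adjoint iso_eta iso_eps).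
have [P1 [P0 [f [p [proj1 proj0 cok]]]]] := modcat_presentation (E X).
exists (G P1), (G P0), (fmor G f), (eta X \oc fmor G p).
split; try exact: (left_adjoint_projective adjG epiE).
exact: cokernel_iso_target (iso_eta X) (left_adjoint_cokernel adjG cok).
Qed.

Lemma equivalence_exact (P P1 P0 X : K) (f : hom P1 P0) (p : hom P0 X)
    (g : hom P P0) :
  is_cokernel f p -> projective P -> p \oc g = 0 -> exists h, f \oc h = g.
Proof.
move=> cok projP pg.
have [G [eta [eps [iso_eta iso_eps]]]] := eqvE.
have adjE := equivalence_left_adjoint iso_eta iso_eps.
have epiG := left_adjoint_epi (equivalence_left_adjoint iso_eps iso_eta).
have [eta' etaK] := nattrans_inverse iso_eta.
have [||h eh] := modcat_exact (left_adjoint_cokernel adjE cok) (g := fmor E g).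
- exact: (left_adjoint_projective adjE epiG).
- by rewrite -fmorM pg fmor0.
exists (eta P1 \oc fmor G h \oc eta' P).
rewrite !compA; have /= <- := ncomp_natural eta f.
rewrite -[_ \oc fmor G h]compA -fmorM eh.
by have /= -> := ncomp_natural eta g; rewrite -compA (etaK P).2 compm1.
Qed.

End EquivalentToModules.

(** * The 2-representation of presentations *)

Section Presentations.

Variables (k : fieldType) (C : twocat k) (fiatC : fiat C) (M : tworep C).

Let pr := pr_rep fiatC M.

(* A morphism between projectives, seen as a morphism of M i; the two types are
   convertible but their compositions differ syntactically. *)
Local Notation inM f := (f : hom (sval _) (sval _)).

Record presentation (i : C) := Presentation {
  parrow : abcat (pr i);
  pcok : M i;
  pproj : hom (sval (atgt parrow)) pcok;
  pprojP : is_cokernel (inM (amap parrow)) pproj }.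

Definition pres_cat (i : C) : kcat k :=
  @KCat k (presentation i) (fun X Y => hom (parrow X) (parrow Y))
    (fun X => idm (parrow X)) (fun X Y Z g f => g \oc f)
    (fun W X Y Z h g f => compA h g f)
    (fun X Y f => comp1m f) (fun X Y f => compm1 f)
    (fun X Y Z f => comp_linearl f) (fun X Y Z g => comp_linearr g).

Lemma eqhom_pres (i : C) (X Y : pres_cat i) (e : X = Y)
    (e' : parrow X = parrow Y) :
  eqhom e = eqhom e' :> hom (parrow X) (parrow Y).
Proof. by case: Y / e e' => e'; rewrite (eqhom_id e'). Qed.

(** The equation et is the image of ea in M i, where the compatibility of the
    cokernel maps is stated. *)
Lemma pres_ext (i : C) (X Y : presentation i) (ea : parrow X = parrow Y)
    (et : sval (atgt (parrow X)) = sval (atgt (parrow Y)))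
    (ec : pcok X = pcok Y) :
  eqhom ec \oc pproj X = pproj Y \oc eqhom et -> X = Y.
Proof.
case: X Y ea et ec => A X p cokp [B Y q cokq] /= ea.
case: B / ea q cokq => q cokq et ec; case: Y / ec q cokq => q cokq /=.
rewrite eqhom_id comp1m compm1 => epq; case: q / epq cokq => cokq.
by rewrite (Prop_irrelevance cokp cokq).
Qed.

Lemma fiat_cokernel (i j : C) (F : hom1 C i j) (X Y Z : M i) (f : hom X Y)
    (p : hom Y Z) :
  is_cokernel f p -> is_cokernel (fmor (tfun M F) f) (fmor (tfun M F) p).
Proof.
have [_ _ _ _ _ [S adj]] := fiatC; have [alpha [beta adjF]] := adj _ _ F.
exact: left_adjoint_cokernel (tfun_left_adjoint M adjF) _ _ _ _ _.
Qed.

Definition pres_map (i j : C) (F : hom1 C i j) (X : presentation i) :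
    presentation j :=
  @Presentation j (abfunctor (tfun pr F) (parrow X)) (tfun M F (pcok X))
    (fmor (tfun M F) (pproj X)) (fiat_cokernel F (pprojP X)).

Definition pres_fun (i j : C) (F : hom1 C i j) :
    functor (pres_cat i) (pres_cat j) :=
  @Functor k (pres_cat i) (pres_cat j) (pres_map F)
    (fun X Y f => fmor (abfunctor (tfun pr F)) f)
    (fun X => fmor1 (abfunctor (tfun pr F)) (parrow X))
    (fun X Y Z g f => fmorM (abfunctor (tfun pr F)) g f)
    (fun X Y => @fmor_linear _ _ _ (abfunctor (tfun pr F)) _ _).

Definition pres_nat (i j : C) (F G : hom1 C i j) (a : hom F G) :
    nattrans (pres_fun F) (pres_fun G) :=
  @NatTrans k _ _ (pres_fun F) (pres_fun G)
    (fun X => abnattrans (tnat pr a) (parrow X))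
    (fun X Y f => ncomp_natural (abnattrans (tnat pr a)) f).

Lemma pres_fun_one (i : C) : pres_fun (one1 i) = functor1 (pres_cat i).
Proof.
have e (X : pres_cat i) : pres_fun (one1 i) X = X.
  apply: (@pres_ext i (pres_map _ X) X
    (eq_fob (tfun_one (abelianization pr) i) (parrow X))
    (eq_fob (tfun_one M i) _) (eq_fob (tfun_one M i) (pcok X))).
  exact: (eq_fmor (tfun_one M i) (pproj X)).
apply: (@functor_ext _ _ _ (pres_fun (one1 i)) (functor1 _) e) => X Y f.
have := eq_fmor (tfun_one (abelianization pr) i) f.
by rewrite -!(eqhom_pres (e _)).
Qed.

Lemma pres_fun_comp (i j l : C) (G : hom1 C j l) (F : hom1 C i j) :
  pres_fun (G \om F) = functorM (pres_fun G) (pres_fun F).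
Proof.
have e (X : pres_cat i) : pres_fun (G \om F) X = pres_fun G (pres_fun F X).
  apply: (@pres_ext l (pres_map _ X) (pres_map _ (pres_map _ X))
    (eq_fob (tfun_comp (abelianization pr) G F) (parrow X))
    (eq_fob (tfun_comp M G F) _) (eq_fob (tfun_comp M G F) (pcok X))).
  exact: (eq_fmor (tfun_comp M G F) (pproj X)).
apply: (@functor_ext _ _ _ (pres_fun (G \om F)) (functorM _ _) e) => X Y f.
have := eq_fmor (tfun_comp (abelianization pr) G F) f.
by rewrite -!(eqhom_pres (e _)).
Qed.

Definition pres_rep : tworep C.
Proof.
refine (@TwoRep k C pres_cat pres_fun pres_nat _ _ pres_fun_one
  pres_fun_comp _).
- by move=> i j F X; exact: (tnat_idm (t := abelianization pr) F (parrow X)).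
- by move=> i j F G H b a X;
    exact: (tnat_comp (t := abelianization pr) b a (parrow X)).
- move=> i j l G G' F F' b a X.
  have := tnat_hcomp (t := abelianization pr) b a (parrow X).
  by rewrite -(eqhom_pres (eq_fob (pres_fun_comp G F) X))
    -(eqhom_pres (eq_fob (pres_fun_comp G' F') X)).
Defined.

(** * Comparison with the abelianization and with M *)

Definition pres_to_ab (i : C) : functor (pres_cat i) (abcat (pr i)) :=
  @Functor k (pres_cat i) (abcat (pr i)) (@parrow i) (fun X Y f => f)
    (fun X => erefl) (fun X Y Z g f => erefl) (fun X Y a f g => erefl).

Lemma pres_to_ab_tfun (i j : C) (F : hom1 C i j) :
  functorM (pres_to_ab j) (tfun pres_rep F)
  = functorM (tfun (abelianization pr) F) (pres_to_ab i).
Proof.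
apply: (@functor_ext k (pres_cat i) (abcat (pr j))
  (functorM (pres_to_ab j) (pres_fun F))
  (functorM (abfunctor (tfun pr F)) (pres_to_ab i)) (fun X => erefl)) => X Y f.
by rewrite [LHS]comp1m [RHS]compm1.
Qed.

Definition pres_to_ab_nat : twonat pres_rep (abelianization pr).
Proof.
refine (@TwoNat k C pres_rep (abelianization pr) pres_to_ab pres_to_ab_tfun _).
by move=> i j F G a X; rewrite !eqhom_id comp1m compm1.
Defined.

(** The map t of cokernels is induced by one, hence by every, square
    representing f. *)
Definition induces (i : C) (X Y : pres_cat i) (f : hom X Y)
    (t : hom (pcok X) (pcok Y)) :=
  exists2 s : square (parrow X) (parrow Y), f = abpi s
    & t \oc pproj X = pproj Y \oc inM (val s).2.

Section Induced.

Variables (i : C) (X Y : pres_cat i).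

Lemma induces_exists (f : hom X Y) : exists t, induces f t.
Proof.
elim/abpi_ind: f => s; have [pX _ cokX] := pprojP X; have [pY _ _] := pprojP Y.
have [|t et] := cokX _ (pproj Y \oc inM (val s).2).
  have sq := squareP s; rewrite -compA.
  have -> : inM (val s).2 \oc inM (amap (parrow X))
    = inM (amap (parrow Y)) \oc inM (val s).1 by exact: sq.
  by rewrite compA pY comp0m.
by exists t, s.
Qed.

(** Two squares representing f differ on the targets by a map factoring through
    the arrow of Y, which the cokernel map of Y kills. *)
Lemma induces_unique (f : hom X Y) t u : induces f t -> induces f u -> t = u.
Proof.
move=> [s es et] [s' es' eu]; have [_ epiX _] := pprojP X.
have [pY _ _] := pprojP Y; apply: epiX; rewrite et eu.
have /quot_piP[xi exi] : abpi s = abpi s' by rewrite -es -es'.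
apply/eqP; rewrite -subr_eq0 -compmN -compmD; apply/eqP.
rewrite [X in _ \oc X]exi.
(* The same composite, read in M i. *)
have e : amap (parrow Y) \oc xi = inM (amap (parrow Y)) \oc inM xi by [].
by rewrite e compA pY comp0m.
Qed.

Definition induced (f : hom X Y) : hom (pcok X) (pcok Y) :=
  sval (cid (induces_exists f)).

Lemma inducedP (f : hom X Y) : induces f (induced f).
Proof. exact: svalP (cid (induces_exists f)). Qed.

Lemma induced_eq (f : hom X Y) t : induces f t -> induced f = t.
Proof. exact/induces_unique/inducedP. Qed.

Lemma induced_linear : linear induced.
Proof.
move=> a f g; apply: induced_eq.
have [s es et] := inducedP f; have [s' es' et'] := inducedP g.
exists (a *: s + s'); first by rewrite {1}es {1}es' abpiP.
rewrite compDm compZm et et'.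
by rewrite -compmZ -compmD.
Qed.

End Induced.

Lemma induced1 (i : C) (X : pres_cat i) : induced (idm X) = idm (pcok X).
Proof.
apply: induced_eq; exists (square1 (parrow X)) => //.
by rewrite comp1m; symmetry; exact: compm1.
Qed.

Lemma inducedM (i : C) (X Y Z : pres_cat i) (g : hom Y Z) (f : hom X Y) :
  induced (g \oc f) = induced g \oc induced f.
Proof.
apply: induced_eq.
have [s es et] := inducedP g; have [s' es' et'] := inducedP f.
exists (squareM s s'); first by rewrite {1}es {1}es'; exact: abcomp_pi.
by rewrite -compA et' compA et -compA.
Qed.

Definition pres_to_rep (i : C) : functor (pres_cat i) (M i) :=
  @Functor k (pres_cat i) (M i) (@pcok i) (@induced i)
    (@induced1 i) (@inducedM i) (@induced_linear i).

Lemma induced_tfun (i j : C) (F : hom1 C i j) (X Y : pres_cat i) (f : hom X Y) :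
  induced (fmor (pres_fun F) f) = fmor (tfun M F) (induced f).
Proof.
apply: induced_eq; have [s es et] := inducedP f.
exists (square_map (tfun pr F) s); first by rewrite {1}es; exact: abmap_pi.
by rewrite -fmorM et fmorM.
Qed.

Lemma induced_tnat (i j : C) (F G : hom1 C i j) (a : hom F G) (X : pres_cat i) :
  induced (pres_nat a X) = tnat M a (pcok X).
Proof.
apply: induced_eq; exists (square_nat (tnat pr a) (parrow X)) => //.
exact: (ncomp_natural (tnat M a) (pproj X)).
Qed.

Lemma pres_to_rep_tfun (i j : C) (F : hom1 C i j) :
  functorM (pres_to_rep j) (tfun pres_rep F)
  = functorM (tfun M F) (pres_to_rep i).
Proof.
apply: (@functor_ext k (pres_cat i) (M j)
  (functorM (pres_to_rep j) (pres_fun F))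
  (functorM (tfun M F) (pres_to_rep i)) (fun X => erefl)) => X Y f.
by rewrite [LHS]comp1m [RHS]compm1; exact: induced_tfun.
Qed.

Definition pres_to_rep_nat : twonat pres_rep M.
Proof.
refine (@TwoNat k C pres_rep M pres_to_rep pres_to_rep_tfun _).
by move=> i j F G a X; rewrite !eqhom_id comp1m compm1; exact: induced_tnat.
Defined.

Hypothesis abM : abelian_rep M.

Lemma pres_to_ab_equivalence (i : C) : is_equivalence (pres_to_ab i).
Proof.
have [A [E eqvE]] := abM i.
apply: fully_faithful_is_equivalence => [//|X Y h|B]; first by exists h.
have [X [p cokp]] := equivalence_cokernel eqvE
  (amap B : hom (sval (asrc B)) (sval (atgt B))).
exists (@Presentation i B X p cokp); exists (idm _), (idm _).
by split; exact: comp1m.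
Qed.

(** Faithfulness and the square over h are the two uses of exactness; the lift c
    of h uses projectivity of the target of X. *)
Lemma pres_to_rep_equivalence (i : C) : is_equivalence (pres_to_rep i).
Proof.
have [A [E eqvE]] := abM i.
apply: fully_faithful_is_equivalence => [X Y f g fg|X Y h|X].
- have [s es et] := inducedP f; have [s' es' et'] := inducedP g.
  rewrite es es'; apply/quot_piP.
  have [|xi exi] := equivalence_exact eqvE (g := (val (s - s')).2)
      (pprojP Y) (svalP (atgt (parrow X))).
    rewrite /= compmD compmN -et -et'.
    by apply/eqP; rewrite subr_eq0; apply/eqP; congr (_ \oc _).
  by exists xi.
- have [pX _ _] := pprojP X; have [pY epiY _] := pprojP Y.
  have [c ec] := svalP (atgt (parrow X)) _ _ _ (h \oc pproj X) epiY.
  have [|b eb] := equivalence_exact eqvE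
      (g := c \oc inM (amap (parrow X)))
      (pprojP Y) (svalP (asrc (parrow X))).
    by rewrite compA ec -compA pX compm0.
  pose s := @mk_square _ _ (parrow X) (parrow Y) b c (esym eb).
  by exists (abpi s); apply: induced_eq; exists s.
have [P1 [P0 [f [p [proj1 proj0 cok]]]]] := equivalence_presentation eqvE X.
pose A1 : pr i := exist _ P1 proj1; pose A0 : pr i := exist _ P0 proj0.
exists (@Presentation i (@Arrow k (pr i) A1 A0 f) X p cok).
by exists (idm _), (idm _); split; exact: comp1m.
Qed.

End Presentations.

Theorem theorem11 (k : fieldType) (C : twocat k) (fiatC : fiat C)
    (M : tworep C) (abM : abelian_rep M) :
  rep_equivalent M (abelianization (pr_rep fiatC M)).
Proof.
exists 2, (fun n => match n with
  | 0 => M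
  | 1 => pres_rep fiatC M
  | _ => abelianization (pr_rep fiatC M) end).
split=> // [[|[|n]]|[|[|n]]] // _.
- move=> i; have [A [E eqvE]] := abM i.
  exists A, (functorM E (pres_to_rep fiatC M i)).
  exact: is_equivalence_comp (pres_to_rep_equivalence fiatC abM i) eqvE.
- move=> i; have [A [E eqvE]] := abM i.
  have [G eqvG] := is_equivalence_inverse (pres_to_ab_equivalence fiatC abM i).
  exists A, (functorM (functorM E (pres_to_rep fiatC M i)) G).
  apply: is_equivalence_comp eqvG _.
  exact: is_equivalence_comp (pres_to_rep_equivalence fiatC abM i) eqvE.
- right; exists (pres_to_rep_nat fiatC M) => i.
  exact: pres_to_rep_equivalence.
left; exists (pres_to_ab_nat fiatC M) => i.
exact: pres_to_ab_equivalence.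
Qed.
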